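(* There is an algorithm that solves CFFA in time $O\big((2t\cdot 2^{2\sqrt{t}}+1)^n\,(n+m)^{O(1)}\big)$, where $n=|\mathcal{A}|$, $m=|\mathcal{I}|$, and $t=\binom{m}{2}-|E(\mathcal{H})|$ is the number of edges whose addition to $\mathcal{H}$ yields a complete graph.
   Context: CFFA: the input is a finite set of agents $\mathcal{A}$, a finite set of jobs $\mathcal{I}$, for each agent $a\in\mathcal{A}$ a utility function $u_a\colon\mathcal{I}\to\mathbb{N}$, a positive integer $\eta$, and a graph $\mathcal{H}$ with vertex set $\mathcal{I}$. The question is whether there is $\phi\colon\mathcal{A}\to 2^{\mathcal{I}}$ such that each $\phi(a)$ is an independent set in $\mathcal{H}$ with $\sum_{x\in\phi(a)}u_a(x)\ge\eta$, and the sets $\phi(a)$, $a\in\mathcal{A}$, are pairwise disjoint. *)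

(* Defs.v *)
From HB Require Import structures.
From mathcomp Require Import all_boot.

Set Implicit Arguments.
Unset Strict Implicit.
Unset Printing Implicit Defensive.

(** * Graphs *)

Record graph (V : finType) := Graph {
  adj : rel V;
  adj_sym : symmetric adj;
  adj_irr : irreflexive adj
}.

Definition edges (V : finType) (H : graph V) : {set {set V}} :=
  [set [set e.1; e.2] | e : V * V & adj H e.1 e.2].

Definition independent (V : finType) (H : graph V) (S : {set V}) : Prop :=
  {in S &, forall x y, ~~ adj H x y}.

(** The subtraction never truncates, since a simple graph on [V] has at most
    ['C(#|V|, 2)] edges. *)
Definition missing_edges (V : finType) (H : graph V) : nat :=
  'C(#|V|, 2) - #|edges H|.

(** * Conflict-free fair allocation *)

Definition CFFA (A J : finType) (u : A -> J -> nat) (eta : nat)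
    (H : graph J) : Prop :=
  exists phi : A -> {set J},
    (forall a, independent H (phi a) /\ eta <= \sum_(x in phi a) u a x) /\
    (forall a b, a != b -> [disjoint phi a & phi b]).

(** * Random access machines

    Structured programs for the unit-cost RAM with addition and truncated
    subtraction on natural numbers. There are no unit-cost multiplications,
    shifts or bitwise operations, which would make unit-cost time on unbounded
    integers unrealistic. A program mentions finitely many registers; the
    unbounded memory is addressed indirectly. *)

Inductive expr :=
| Const of nat
| Reg of nat
| Read of expr
| Add of expr & expr
| Sub of expr & expr.

(** The guards of [If] and [While] hold when their value is nonzero, so that
    [Sub e2 e1] tests [e1 < e2]. *)
Inductive program :=
| Skip
| Assign of nat & expr
| Write of expr & expr
| Seq of program & program
| If of expr & program & program
| While of expr & program.

Record state := State { regs : nat -> nat; memory : nat -> nat }.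

Definition update (f : nat -> nat) (i v : nat) : nat -> nat :=
  fun j => if j == i then v else f j.

Definition set_reg (s : state) r v := State (update (regs s) r v) (memory s).
Definition set_mem (s : state) a v := State (regs s) (update (memory s) a v).

Fixpoint eval (s : state) (e : expr) : nat :=
  match e with
  | Const k => k
  | Reg r => regs s r
  | Read e => memory s (eval s e)
  | Add e1 e2 => eval s e1 + eval s e2
  | Sub e1 e2 => eval s e1 - eval s e2
  end.

Fixpoint cost (e : expr) : nat :=
  match e with
  | Const _ | Reg _ => 1
  | Read e => (cost e).+1
  | Add e1 e2 | Sub e1 e2 => (cost e1 + cost e2).+1
  end.

(** [exec p s T s']: started in state [s], the program [p] halts in state [s']
    after exactly [T] elementary steps. *)
Inductive exec : program -> state -> nat -> state -> Prop :=
| ExecSkip s : exec Skip s 1 s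
| ExecAssign s r e :
    exec (Assign r e) s (cost e).+1 (set_reg s r (eval s e))
| ExecWrite s e1 e2 :
    exec (Write e1 e2) s (cost e1 + cost e2).+1
         (set_mem s (eval s e1) (eval s e2))
| ExecSeq p1 p2 s s1 s2 T1 T2 :
    exec p1 s T1 s1 -> exec p2 s1 T2 s2 ->
    exec (Seq p1 p2) s (T1 + T2) s2
| ExecIfTrue e p1 p2 s s' T :
    eval s e != 0 -> exec p1 s T s' ->
    exec (If e p1 p2) s (cost e + T).+1 s'
| ExecIfFalse e p1 p2 s s' T :
    eval s e = 0 -> exec p2 s T s' ->
    exec (If e p1 p2) s (cost e + T).+1 s'
| ExecWhileTrue e p s s1 s2 T1 T2 :
    eval s e != 0 -> exec p s T1 s1 -> exec (While e p) s1 T2 s2 ->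
    exec (While e p) s (cost e + T1 + T2).+1 s2
| ExecWhileFalse e p s :
    eval s e = 0 -> exec (While e p) s (cost e).+1 s.

Lemma exec_det p s T1 s1 T2 s2 :
  exec p s T1 s1 -> exec p s T2 s2 -> T1 = T2 /\ s1 = s2.
Proof.
move=> ex1; elim: ex1 T2 s2 => {p s T1 s1} *;
  match goal with ex : exec _ _ _ _ |- _ = _ /\ _ => inversion ex; subst end;
  try (by []);
  try match goal with
  | nz : is_true (eval ?s ?e != 0), z : eval ?s ?e = 0 |- _ =>
      by rewrite z in nz
  end;
  repeat match goal with
  | IH : forall T s', exec ?p ?s T s' -> _, ex : exec ?p ?s _ _ |- _ =>
      case: (IH _ _ ex) => ? ?; subst; clear ex
  end; by [].
Qed.

(** The input occupies an initial segment of the memory; all other memory cells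
    and all registers are zero. *)
Definition init (input : seq nat) : state :=
  State (fun=> 0) (nth 0 input).

(** The answer is read off register 0 upon termination. *)
Definition accepting (s : state) : Prop := regs s 0 <> 0.

(** The utilities and the adjacency matrix are written row by row. *)
Definition encode (A J : finType) (u : A -> J -> nat) (eta : nat)
    (H : graph J) : seq nat :=
  [:: #|A|; #|J|; eta]
    ++ [seq u a x | a <- enum A, x <- enum J]
    ++ [seq nat_of_bool (adj H x y) | x <- enum J, y <- enum J].

(* Main.v *)
Require Import Defs.
From mathcomp Require Import all_boot all_order all_algebra zify.
From mathcomp Require Import reals exp.

Set Implicit Arguments.
Unset Strict Implicit.
Unset Printing Implicit Defensive.

(** An agent that gets at least two jobs gets one of the [K] independent sets
    with at least two elements. The program lists these sets and tries the
    [(K + 1) ^ n] ways to give each agent one of them or the label "single job";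
    what remains is a bipartite matching problem between the agents with that
    label and the unused jobs. It is solved by an auction: an unmatched agent
    takes a cheapest acceptable job, evicting its owner, and the price of that
    job goes up by one. If all the jobs acceptable to an unmatched agent cost at
    least [n], then a perfect matching would give, for each [k < n], fewer
    agents that only accept jobs of price at least [k + 1] than agents that only
    accept jobs of price at least [k], hence more than [n] agents.

    Independent sets are cliques of the complement of [H], which has [t] edges.
    A vertex of least positive degree [k] of that graph satisfies
    [k * (k + 1) <= 2 * t] and lies in at most [2 ^ k] cliques; removing such
    vertices one by one shows that [K <= t * 2 ^ d] for the largest [d] with
    [d * (d + 1) <= 2 * t]. *)

(** * Total correctness with time bounds *)

(** Since [eta] is positive, every agent of a solution gets a job, so an agent with fewer than two
    jobs has exactly one; the labels of a word therefore cover all cases. The auction stops because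
    a bid raises by one a price that is below [n]: at most [n * m] bids are possible, so a word
    costs polynomial time and the only exponential factor is the number of words. Listing the [K]
    sets also costs time proportional to [K]. For [n >= 1] this is absorbed by
    [K + 1 <= (K + 1) ^ n]; for [n = 0] the claimed bound is polynomial, so that case must be
    answered without listing anything. The machine has no multiplication. Letters are therefore
    stored as equally spaced addresses, and counting through the words only adds the row length. The
    constants come from [d ^ 2 <= d * (d + 1) <= 2 * t <= (2 * sqrt t) ^ 2] and [t <= 2 * t]; the
    final [+ 1] is the label of the agents with a single job. *)

Definition wp (p : program) (s : state) (T : nat) (Q : state -> Prop) : Prop :=
  exists T' s', [/\ exec p s T' s', T' <= T & Q s'].

Lemma wp_mono p s T T' (Q Q' : state -> Prop) :
  wp p s T Q -> T <= T' -> (forall s', Q s' -> Q' s') -> wp p s T' Q'.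
Proof.
move=> [T0 [s' [ex le qs]]] le' qq; exists T0, s'; split=> //; last exact: qq.
exact: leq_trans le le'.
Qed.

Lemma wp_le T p s T' Q : wp p s T Q -> T <= T' -> wp p s T' Q.
Proof. by move=> w le; apply: wp_mono w le _. Qed.

Lemma wp_skip s (Q : state -> Prop) : Q s -> wp Skip s 1 Q.
Proof. by exists 1, s; split=> //; constructor. Qed.

Lemma wp_assign r e s (Q : state -> Prop) :
  Q (set_reg s r (eval s e)) -> wp (Assign r e) s (cost e).+1 Q.
Proof. by eexists; eexists; split; [constructor | | eassumption]. Qed.

Lemma wp_write e1 e2 s (Q : state -> Prop) :
  Q (set_mem s (eval s e1) (eval s e2)) ->
  wp (Write e1 e2) s (cost e1 + cost e2).+1 Q.
Proof. by eexists; eexists; split; [constructor | | eassumption]. Qed.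

Lemma wp_seq p1 p2 s T1 T2 Q :
  wp p1 s T1 (fun s1 => wp p2 s1 T2 Q) -> wp (Seq p1 p2) s (T1 + T2) Q.
Proof.
move=> [t1 [s1 [ex1 le1 [t2 [s2 [ex2 le2 q]]]]]].
by exists (t1 + t2), s2; split=> //; [econstructor; eassumption | apply: leq_add].
Qed.

Lemma wp_if e p1 p2 s T1 T2 Q :
  (eval s e != 0 -> wp p1 s T1 Q) -> (eval s e = 0 -> wp p2 s T2 Q) ->
  wp (If e p1 p2) s (cost e + T1 + T2).+1 Q.
Proof.
move=> w1 w2; have [z|nz] := eqVneq (eval s e) 0.
  have [t [s' [ex le q]]] := w2 z.
  by exists (cost e + t).+1, s'; split=> //; [apply: ExecIfFalse | lia].
have [t [s' [ex le q]]] := w1 nz.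
by exists (cost e + t).+1, s'; split=> //; [apply: ExecIfTrue | lia].
Qed.

Lemma wp_while_true e p s T1 T2 Q :
  eval s e != 0 -> wp p s T1 (fun s1 => wp (While e p) s1 T2 Q) ->
  wp (While e p) s (cost e + T1 + T2).+1 Q.
Proof.
move=> nz [t1 [s1 [ex1 le1 [t2 [s2 [ex2 le2 q]]]]]].
exists (cost e + t1 + t2).+1, s2; split=> //; last lia.
by apply: ExecWhileTrue ex2.
Qed.

Lemma wp_while_false e p s (Q : state -> Prop) :
  eval s e = 0 -> Q s -> wp (While e p) s (cost e).+1 Q.
Proof. by exists (cost e).+1, s; split=> //; apply: ExecWhileFalse. Qed.

(** The index of [I] is a variant: it bounds the remaining rounds, and at index 0 a true guard is
    contradictory because the body would have to reach a smaller index. The extra round in [k.+1]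
    pays for the last test of the guard. *)
Lemma wp_while (I : nat -> state -> Prop) B k e p s (Q : state -> Prop) :
  I k s ->
  (forall i s, I i s -> eval s e != 0 ->
     wp p s B (fun s' => exists2 j, j < i & I j s')) ->
  (forall i s, I i s -> eval s e = 0 -> Q s) ->
  wp (While e p) s (k.+1 * (cost e + B).+1) Q.
Proof.
move=> Ik step stop; elim/ltn_ind: k s Ik => k IH s Ik.
have [z|nz] := eqVneq (eval s e) 0.
  apply: (wp_le (T := (cost e).+1)); last by nia.
  by apply: wp_while_false => //; apply: stop Ik z.
case: k IH Ik => [|k] IH Ik; first by have [? [? [_ _ []]]] := step _ _ Ik nz.
apply: (wp_le (T := (cost e + B + k.+1 * (cost e + B).+1).+1)); last by nia.
apply: wp_while_true => //; apply: wp_mono (step _ _ Ik nz) (leqnn _) _.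
move=> s' [j lt Ij]; apply: wp_le (IH _ lt _ Ij) _.
by rewrite leq_mul2r ltnS; lia.
Qed.

Fixpoint assigned (p : program) : seq nat :=
  match p with
  | Skip | Write _ _ => [::]
  | Assign r _ => [:: r]
  | Seq p1 p2 | If _ p1 p2 => assigned p1 ++ assigned p2
  | While _ p => assigned p
  end.

Definition same_regs (rs : seq nat) (s s' : state) : Prop :=
  forall r, r \notin rs -> regs s' r = regs s r.

Lemma exec_frame p s T s' : exec p s T s' -> same_regs (assigned p) s s'.
Proof.
elim=> {p s T s'} //=; rewrite /same_regs.
- by move=> s r e r'; rewrite inE /= /update => /negPf->.
- move=> p1 p2 s s1 s2 T1 T2 _ IH1 _ IH2 r; rewrite mem_cat negb_or.
  by case/andP=> /IH1<- /IH2.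
- by move=> e p1 p2 s s' T _ _ IH r; rewrite mem_cat negb_or => /andP[/IH].
- by move=> e p1 p2 s s' T _ _ IH r; rewrite mem_cat negb_or => /andP[_ /IH].
- by move=> e p s s1 s2 T1 T2 _ _ IH1 _ IH2 r rP; rewrite IH2 // IH1.
Qed.

(** The registers left alone are read off the syntax of [p], so specifications need not mention
    them. Memory has no such frame because addresses are computed; each specification states which
    cells survive. *)
Lemma wp_frame p s T T' (Q Q' : state -> Prop) :
  wp p s T Q -> T <= T' ->
  (forall s', same_regs (assigned p) s s' -> Q s' -> Q' s') -> wp p s T' Q'.
Proof.
move=> [T0 [s' [ex le q]]] le' qq; exists T0, s'; split=> //.
  exact: leq_trans le le'.
by apply: qq q; apply: exec_frame ex.
Qed.

Local Notation "r <:- e" := (Assign r e) (at level 70).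
Local Notation "'M[' e1 ] <:- e2" := (Write e1 e2) (at level 70).
Local Notation "p1 ;; p2" := (Seq p1 p2) (at level 90, right associativity).
Local Infix ":+" := Defs.Add (at level 50, left associativity).
Local Infix ":-" := Defs.Sub (at level 50, left associativity).

Definition For (r lim : nat) (body : program) : program :=
  r <:- Const 0 ;;
  While (Reg lim :- Reg r) (body ;; r <:- Reg r :+ Const 1).

Lemma wp_for (I : nat -> state -> Prop) B r lim body s Q :
  [&& lim != r, r \notin assigned body & lim \notin assigned body] ->
  I 0 (set_reg s r 0) ->
  (forall i s', i < regs s lim -> regs s' r = i ->
     same_regs (r :: assigned body) s s' -> I i s' ->
     wp body s' B (fun s'' => I i.+1 (set_reg s'' r i.+1))) ->
  (forall s', same_regs (r :: assigned body) s s' -> I (regs s lim) s' -> Q s') ->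
  wp (For r lim body) s ((regs s lim).+1 * (B + 8)) Q.
Proof.
case/and3P=> lr rb lb I0 step stop; set b := regs s lim.
(* A round costs 4 for the guard, [B] for the body and 4 for the increment. Initializing the counter
   takes 2 steps, split off here, and the failing last test takes 4; the extra round pays for
   both. *)
apply: (@wp_le (2 + b.+1 * (3 + (B + 4)).+1 - 2)); last by nia.
rewrite -addnBA; last by nia.
pose J k s' := exists i, [/\ k + i = b, regs s' r = i,
  same_regs (r :: assigned body) s s' & I i s'].
have fr s' : same_regs (r :: assigned body) s s' -> regs s' lim = b.
  by move=> -> //; rewrite inE negb_or lr.
have J0 : J b (set_reg s r 0).
  exists 0; split=> //; first by rewrite addn0.
    by rewrite /= /update eqxx.
  by move=> r'; rewrite inE negb_or /= /update => /andP[/negPf-> _].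
have w k s0 : J k s0 -> k <= b ->
    wp (While (Reg lim :- Reg r) (body ;; r <:- Reg r :+ Const 1)) s0
      (k * (3 + (B + 4)).+1 + 4) Q.
  elim: k s0 => [|k IH] s0 [i [ki ri sr Ii]] kb.
    rewrite mul0n; apply: wp_while_false; first by rewrite /= fr // ri; lia.
    by apply: stop => //; rewrite -/b -ki.
  apply: (@wp_le (3 + (B + 4) + (k * (3 + (B + 4)).+1 + 4)).+1); last by lia.
  apply: wp_while_true; first by rewrite /= fr // ri; lia.
  apply: wp_seq.
  apply: wp_frame (step i _ _ ri sr Ii) (leqnn _) _; first by lia.
  move=> s1 sr1 I1; apply: (wp_assign (e := Reg r :+ Const 1)).
  rewrite /= (sr1 r) // ri addn1; apply: IH; last by lia.
  exists i.+1; split=> //; first by lia.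
    by rewrite /= /update eqxx.
  move=> r' r'P; have := r'P; rewrite inE negb_or => /andP[/negPf r'r r'b].
  by rewrite /= /update r'r sr1 // sr.
apply: wp_seq; apply: (wp_assign (e := Const 0)).
by apply: wp_le (w _ _ J0 (leqnn _)) _; lia.
Qed.

Lemma wp_for_eq k (I : nat -> state -> Prop) B r lim body s Q :
  regs s lim = k ->
  [&& lim != r, r \notin assigned body & lim \notin assigned body] ->
  I 0 (set_reg s r 0) ->
  (forall i s', i < k -> regs s' r = i ->
     same_regs (r :: assigned body) s s' -> I i s' ->
     wp body s' B (fun s'' => I i.+1 (set_reg s'' r i.+1))) ->
  (forall s', same_regs (r :: assigned body) s s' -> I k s' -> Q s') ->
  wp (For r lim body) s (k.+1 * (B + 8)) Q.
Proof. by move=> <-; apply: wp_for. Qed.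

(** * Bundles, auctions and words *)

Section Bundles.

Variable E : rel nat.

Definition compatible (x : nat) (B : seq nat) : bool :=
  all (fun y => ~~ E x y) B.

Definition extend (x : nat) (Bs : seq (seq nat)) : seq (seq nat) :=
  [seq x :: B | B <- Bs & compatible x B].

Definition singletons (x : nat) : seq (seq nat) := [seq [:: y] | y <- iota 0 x].

(** Sets are strictly decreasing lists, sorted by their largest element [x]: what remains after
    removing [x] is nonempty, hence a singleton or an earlier bundle. The recursion only appends, so
    the program can grow one table in place. *)
Fixpoint bundles (m : nat) : seq (seq nat) :=
  if m is x.+1 then bundles x ++ extend x (singletons x ++ bundles x) else [::].

Lemma mem_extend x Bs y B :
  (y :: B \in extend x Bs) = [&& y == x, compatible x B & B \in Bs].
Proof.
apply/mapP/and3P=> [[B' + [-> ->]]|[/eqP-> cS SS]].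
  by rewrite mem_filter => /andP[? ?]; split.
by exists B => //; rewrite mem_filter cS.
Qed.

Lemma mem_bundles m B :
  (B \in bundles m) = [&& 1 < size B, sorted gtn B, all (gtn m) B
                         & pairwise (fun x y => ~~ E x y) B].
Proof.
have gtn_trans : transitive gtn by move=> y x z /= xy yz; apply: ltn_trans yz xy.
elim: m B => [|m IH] [|x B] //=; first by rewrite in_nil !andbF.
  by rewrite mem_cat IH; apply/mapP=> -[].
rewrite mem_cat IH mem_extend mem_cat IH /= !(path_sortedE gtn_trans).
have [->|xm] := eqVneq x m.
  rewrite ltnn ltnSn /= !andbF /= -/(compatible m B).
  have -> : (B \in singletons m) = (size B == 1) && all (gtn m) B.
    apply/mapP/andP=> [[y + ->]|[]]; first by rewrite mem_iota /= add0n => ->.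
    case: B => [|y []] //= _; rewrite andbT => ym.
    by exists y; rewrite // mem_iota.
  have [Sm|nSm] := boolP (all (gtn m) B); last by rewrite /= !andbF.
  have -> : all (gtn m.+1) B.
    by apply: sub_all Sm => y /=; apply: leqW.
  case: (compatible m B); rewrite ?andbF ?andbT //=.
  by case: B {IH Sm} => [|y [|z B]].
rewrite orbF.
have -> : (x < m.+1) = (x < m) by rewrite ltnS leq_eqVlt (negPf xm).
have [xm'|] := ltnP x m; last by rewrite /= !andbF.
have [Sx|] := boolP (all (gtn x) B); last by rewrite /= !andbF.
have aS k : x < k -> all (gtn k) B by move=> xk; apply: sub_all Sx => y /=; lia.
by rewrite !aS //; lia.
Qed.

(** Serves to bound the length of the list by the number of cliques. *)
Lemma bundles_uniq m : uniq (bundles m).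
Proof.
elim: m => //= x IH; rewrite cat_uniq IH map_inj_uniq; last by move=> ? ? [].
rewrite filter_uniq ?andbT /=; last first.
  rewrite cat_uniq IH andbT map_inj_uniq ?iota_uniq; last by move=> ? ? [].
  apply/hasPn=> B; rewrite mem_bundles => /andP[S1 _].
  by apply/mapP=> -[y _ Sy]; rewrite Sy in S1.
apply/hasPn=> _ /mapP[B _ ->]; rewrite /= mem_bundles /=.
by rewrite ltnn !andbF.
Qed.

(** Lets each round of the enumeration be charged for the final table. *)
Lemma leq_size_bundles x m : x <= m -> size (bundles x) <= size (bundles m).
Proof.
elim: m => [|m IH]; first by rewrite leqn0 => /eqP->.
rewrite leq_eqVlt => /predU1P[->//|/IH le].
by rewrite /= size_cat; apply: leq_trans le (leq_addr _ _).
Qed.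

End Bundles.

(** * Bipartite matching by an auction *)

Section Auction.

Variables (n m : nat) (acc : rel nat) (sg : pred nat).

Definition matching (f : nat -> nat) : Prop :=
  (forall a, a < n -> sg a -> f a < m /\ acc a (f a)) /\
  (forall a b, a < n -> b < n -> sg a -> sg b -> f a = f b -> a = b).

Definition owned (o : nat -> option nat) (a : nat) : Prop :=
  exists2 x, x < m & o x = Some a.

(** Complementary slackness with slack one, for the dual solution given by the
    prices [p]. *)
Definition auction_inv (p : nat -> nat) (o : nat -> option nat) : Prop :=
  [/\ forall x a, x < m -> o x = Some a ->
        [/\ a < n, sg a & acc a x /\ (forall y, y < m -> acc a y -> p x <= (p y).+1)],
      forall x, x < m -> 0 < p x -> o x <> None,
      forall x y a, x < m -> y < m -> o x = Some a -> o y = Some a -> x = y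
    & forall x, x < m -> p x <= n].

(** The comparison of agents passes through jobs. [f] injects [S k] into the set [L k] of jobs of
    price at least [k], and ownership injects [L k.+1] into [S k] without [c]. Hence
    [#|S k.+1| <= #|L k.+1| < #|S k|] for all [k < n], while [c] lies in [S n]. *)
Lemma auction_stuck p o c :
  auction_inv p o -> c < n -> sg c -> ~ owned o c ->
  (forall y, y < m -> acc c y -> n <= p y) -> ~ exists f, matching f.
Proof.
move=> [own pos inj _] cn sc nown stuck [f [fP f_inj]].
have [fcm accf] := fP c cn sc.
pose x0 := Ordinal fcm; pose c0 := Ordinal cn.
pose L k := [set x : 'I_m | k <= p x].
pose S k := [set a : 'I_n | sg a & [forall x : 'I_m, acc a x ==> (k <= p x)]].
have cS k : k <= n -> c0 \in S k.
  move=> kn; rewrite inE sc; apply/forallP=> x; apply/implyP=> ac.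
  exact: leq_trans kn (stuck _ (ltn_ord x) ac).
have SL k : #|S k| <= #|L k|.
  (* The defaults [x0] and [c0] of [insubd] exist because [c] is an agent and [f] gives it a job. *)
  pose g (a : 'I_n) : 'I_m := insubd x0 (f a).
  have gE (a : 'I_n) : sg a -> val (g a) = f a.
    by move=> sa; rewrite val_insubd (fP a (ltn_ord a) sa).1.
  rewrite -(card_in_imset (f := g)); last first.
    move=> a b; rewrite !inE => /andP[sa _] /andP[sb _] /(congr1 val).
    by rewrite !gE // => /f_inj ab; apply/val_inj/ab.
  apply/subset_leq_card/subsetP=> _ /imsetP[a + ->].
  rewrite !inE => /andP[sa /forallP/(_ (g a))/implyP]; apply.
  by rewrite gE //; apply: (fP a _ sa).2.
(* A job of price at least [k + 1] has an owner, and slack one forces all jobs acceptable to that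
   owner to cost at least [k]. The agent [c] owns nothing, which makes the inequality strict. *)
have LS k : k < n -> #|L k.+1| < #|S k|.
  move=> kn; rewrite (cardsD1 c0) cS ?ltnS; last exact: ltnW.
  pose h (x : 'I_m) : 'I_n := insubd c0 (odflt 0 (o x)).
  have hP x : x \in L k.+1 -> o x = Some (val (h x)).
    rewrite inE => px; have := pos x (ltn_ord x) (leq_ltn_trans (leq0n _) px).
    case ox: (o x) => [a|] // _; rewrite val_insubd /= ox /=.
    by have [-> _ _] := own x a (ltn_ord x) ox.
  rewrite -(card_in_imset (f := h)); last first.
    move=> x y /hP ox /hP oy hxy; apply: val_inj.
    by apply: inj (ltn_ord x) (ltn_ord y) ox _; rewrite hxy.
  apply/subset_leq_card/subsetP=> _ /imsetP[x xL ->].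
  have [_ sa [_ slack]] := own _ _ (ltn_ord x) (hP x xL).
  rewrite !inE sa; apply/andP; split.
    apply/eqP=> hx; apply: nown; exists x => //.
    by rewrite hP // hx.
  apply/forallP=> y; apply/implyP=> /(slack y (ltn_ord y)).
  by move: xL; rewrite inE; lia.
have Sn j : j <= n -> j < #|S (n - j)|.
  elim: j => [|j IH] jn; first by apply/card_gt0P; exists c0; apply: cS; lia.
  have := LS (n - j.+1); rewrite -subSn // subSS.
  by have := SL (n - j); have := IH (ltnW jn); lia.
have := Sn n (leqnn _).
suff: #|S (n - n)| <= n by lia.
by apply: leq_trans (max_card _) _; rewrite card_ord.
Qed.

(** The new owner took a cheapest job, so after the increase its price exceeds the others by at most
    one. For the other owners the price of their own job is unchanged and the remaining prices only
    rise. *)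
Lemma auction_step p o p' o' c x :
  auction_inv p o -> c < n -> sg c -> ~ owned o c ->
  x < m -> acc c x -> p x < n ->
  (forall y, y < m -> acc c y -> p x <= p y) ->
  (forall y, p' y = if y == x then (p x).+1 else p y) ->
  (forall y, o' y = if y == x then Some c else o y) ->
  [/\ auction_inv p' o',
      forall b, owned o b -> o x <> Some b -> owned o' b,
      owned o' c &
      forall b, o x = Some b -> ~ owned o' b].
Proof.
move=> [own pos inj bound] cn sc nown xm acx pxn best p'E o'E.
have pp' y : p y <= p' y by rewrite p'E; case: eqP => // ->.
split.
- split.
  + move=> y a ym; rewrite o'E p'E; case: eqP => [-> [<-]|yx oy].
      by split=> //; split=> // z zm /(best z zm); have := pp' z; lia.
    have [an sa [aa slack]] := own y a ym oy; split=> //; split=> // z zm az.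
    by have := pp' z; have := slack z zm az; lia.
  + by move=> y ym; rewrite o'E p'E; case: eqP => // _; apply: pos.
  + move=> y z a ym zm; rewrite !o'E.
    case: eqP => [-> [<-]|yx oy]; case: eqP => [->//|zx oz].
    * by case: nown; exists z.
    * by move=> [ca]; case: nown; exists y; rewrite // ca.
    * exact: inj oy oz.
  + by move=> y ym; rewrite p'E; case: eqP => // _; apply: bound.
- move=> b [y ym oy] oxb; exists y => //; rewrite o'E; case: eqP => // yx.
  by case: oxb; rewrite -yx.
- by exists x => //; rewrite o'E eqxx.
- move=> b oxb [y ym]; rewrite o'E; case: eqP => [_ [cb]|yx oy].
    by apply: nown; rewrite cb; exists x.
  by case: yx; apply: inj ym xm oy oxb.
Qed.

End Auction.

(** * Counting through words in base [b] *)

Section Odometer.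

Variable b : nat.

(** The least significant digit comes first, so a carry moves to the tail; [None] signals
    overflow. *)
Fixpoint next_word (w : seq nat) : option (seq nat) :=
  if w is d :: w' then
    if d.+1 < b then Some (d.+1 :: w') else omap (cons 0) (next_word w')
  else None.

Definition word (n : nat) (w : seq nat) : bool :=
  (size w == n) && all (fun d => d < b) w.

Fixpoint word_value (w : seq nat) : nat :=
  if w is d :: w' then d + b * word_value w' else 0.

Lemma word_value_lt w : all (fun d => d < b) w -> word_value w < b ^ size w.
Proof. by elim: w => //= d w IH /andP[db /IH]; rewrite expnS; nia. Qed.

Lemma word_value_inj n w w' :
  word n w -> word n w' -> word_value w = word_value w' -> w = w'.
Proof.
elim: n w w' => [|n IH] [|d w] [|d' w'] //=.
rewrite /word /= !eqSS => /and3P[sw db aw] /and3P[sw' db' aw'] e.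
have ww : word_value w = word_value w' by nia.
by rewrite (IH w w') ?/word ?sw ?sw' //; congr cons; nia.
Qed.

(** In the carry case the head is [b - 1], and [(b - 1) + b * v + 1 = 0 + b * (v + 1)]. *)
Lemma next_wordP n w : word n w ->
  if next_word w is Some w' then word n w' /\ word_value w' = (word_value w).+1
  else (word_value w).+1 = b ^ n.
Proof.
elim: n w => [|n IH] [|d w] //; rewrite /word /= eqSS => /and3P[sw db aw].
case: ifP => [db'|db'] /=; first by rewrite eqSS sw db' aw.
have := IH w; rewrite /word sw aw => /(_ isT).
case: (next_word w) => [w'|] /=; last by rewrite expnS => <-; nia.
by move=> [/andP[sw' ->] ->]; rewrite eqSS sw' andbT; split; nia.
Qed.

End Odometer.

(** * The program *)

(** Tables have one row of [m + 1] cells per set of jobs, so that distinct rows have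
    distinct addresses even if [m = 0]; a set is denoted by the address of its
    row, and an agent by the address of its row of utilities. The letters of the
    current word are the cells from [rDigits] on. *)
Local Notation rAns := 0.
Local Notation rN := 1.
Local Notation rM := 2.
Local Notation rEta := 3.
Local Notation rStride := 4.
Local Notation rAdj := 5.
Local Notation rUsed := 6.
Local Notation rPrice := 7.
Local Notation rOwner := 8.
Local Notation rDigits := 9.
Local Notation rSingle := 10.
Local Notation rMark := 11.
Local Notation rList := 12.
Local Notation rEnd := 13.
Local Notation rX := 14.
Local Notation rAdjRow := 15.
Local Notation rSingleEnd := 16.
Local Notation rOldEnd := 17.
Local Notation rRow := 18.
Local Notation rOk := 19.
Local Notation rY := 20.
Local Notation rA := 21.
Local Notation rUtil := 22.
Local Notation rDigit := 23.
Local Notation rSum := 24.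
Local Notation rFail := 25.
Local Notation rCur := 26.
Local Notation rBest := 27.
Local Notation rItem := 28.
Local Notation rTmp := 29.
Local Notation rGo := 30.
Local Notation rCarry := 31.

(** The row is copied before compatibility is known. A rejected copy stays beyond [rEnd], where the
    next candidate overwrites all its cells. *)
Definition extend_row : program :=
  rOk <:- Const 1 ;;
  For rY rM (
    M[Reg rEnd :+ Reg rY] <:- Read (Reg rRow :+ Reg rY) ;;
    If (Read (Reg rRow :+ Reg rY))
       (If (Read (Reg rAdjRow :+ Reg rY)) (rOk <:- Const 0) Skip)
       Skip) ;;
  M[Reg rEnd :+ Reg rX] <:- Const 1 ;;
  If (Reg rOk) (rEnd <:- Reg rEnd :+ Reg rStride) Skip.

Definition extend_rows (lim : nat) : program :=
  While (Reg lim :- Reg rRow)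
    (extend_row ;; rRow <:- Reg rRow :+ Reg rStride).

(** [rOldEnd] freezes the end of the table at the start of a round, so that the second pass does not
    extend the rows appended in the same round. [rSingleEnd] grows with [rX], so that the first pass
    sees only singletons of smaller jobs. *)
Definition enumerate : program :=
  rEnd <:- Reg rList ;;
  rAdjRow <:- Reg rAdj ;;
  rSingleEnd <:- Reg rSingle ;;
  For rX rM (
    rOldEnd <:- Reg rEnd ;;
    rRow <:- Reg rSingle ;;
    extend_rows rSingleEnd ;;
    rRow <:- Reg rList ;;
    extend_rows rOldEnd ;;
    rAdjRow <:- Reg rAdjRow :+ Reg rM ;;
    rSingleEnd <:- Reg rSingleEnd :+ Reg rStride).

Definition clear_items : program :=
  For rY rM (
    M[Reg rUsed :+ Reg rY] <:- Const 0 ;;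
    M[Reg rPrice :+ Reg rY] <:- Const 0 ;;
    M[Reg rOwner :+ Reg rY] <:- Const 0).

(** [rFail] accumulates natural numbers: conflicts with used jobs and the truncated deficit
    [eta - sum]. It stays zero exactly if all of them vanish. *)
Definition check_bundle : program :=
  rSum <:- Const 0 ;;
  For rY rM (
    If (Read (Reg rDigit :+ Reg rY)) (
      rSum <:- Reg rSum :+ Read (Reg rUtil :+ Reg rY) ;;
      rFail <:- Reg rFail :+ Read (Reg rUsed :+ Reg rY) ;;
      M[Reg rUsed :+ Reg rY] <:- Const 1)
    Skip) ;;
  rFail <:- Reg rFail :+ (Reg rEta :- Reg rSum).

Definition check_bundles : program :=
  rUtil <:- Const 3 ;;
  For rA rN (
    rDigit <:- Read (Reg rDigits :+ Reg rA) ;;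
    If (Reg rDigit :- Reg rMark) check_bundle Skip ;;
    rUtil <:- Reg rUtil :+ Reg rM).

(** Starting [rBest] at [n] rules out jobs of price at least [n]. [rItem] holds the job plus one, so
    that 0 means that none was found. *)
Definition find_cheapest : program :=
  rBest <:- Reg rN ;;
  rItem <:- Const 0 ;;
  For rY rM (
    If (Read (Reg rUsed :+ Reg rY)) Skip (
    If (Reg rEta :- Read (Reg rCur :+ Reg rY)) Skip (
    If (Reg rBest :- Read (Reg rPrice :+ Reg rY)) (
      rBest <:- Read (Reg rPrice :+ Reg rY) ;;
      rItem <:- Reg rY :+ Const 1)
    Skip))).

(** [rCur] holds the utility row of the agent still to be placed; such an address is at least 3, so
    0 can mean that nobody is left, and an empty owner cell ends the loop. *)
Definition insert_agent : program :=
  While (Reg rCur) (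
    find_cheapest ;;
    If (Reg rItem) (
      rY <:- Reg rItem :- Const 1 ;;
      M[Reg rPrice :+ Reg rY] <:- Reg rBest :+ Const 1 ;;
      rTmp <:- Read (Reg rOwner :+ Reg rY) ;;
      M[Reg rOwner :+ Reg rY] <:- Reg rCur ;;
      rCur <:- Reg rTmp)
    (
      rFail <:- Const 1 ;;
      rCur <:- Const 0)).

Definition auction : program :=
  rUtil <:- Const 3 ;;
  For rA rN (
    If (Read (Reg rDigits :+ Reg rA) :- Reg rMark) Skip (
      rCur <:- Reg rUtil ;;
      insert_agent) ;;
    rUtil <:- Reg rUtil :+ Reg rM).

Definition check_word : program :=
  rFail <:- Const 0 ;; clear_items ;; check_bundles ;; auction.

(** The table of bundles starts one row after [rMark], so the rows of the letters are contiguous: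
    adding [rStride] gives the next letter, and reaching [rEnd] means that the letter was the last
    one. *)
Definition next_digits : program :=
  rA <:- Const 0 ;;
  rCarry <:- Const 1 ;;
  While (Reg rCarry) (
    If (Reg rN :- Reg rA) (
      rDigit <:- Read (Reg rDigits :+ Reg rA) :+ Reg rStride ;;
      If (Reg rEnd :- Reg rDigit) (
        M[Reg rDigits :+ Reg rA] <:- Reg rDigit ;;
        rCarry <:- Const 0)
      (
        M[Reg rDigits :+ Reg rA] <:- Reg rMark ;;
        rA <:- Reg rA :+ Const 1))
    (
      rCarry <:- Const 0 ;;
      rGo <:- Const 0)).

Definition search : program :=
  For rA rN (M[Reg rDigits :+ Reg rA] <:- Reg rMark) ;;
  rGo <:- Const 1 ;;
  While (Reg rGo) (
    check_word ;;
    If (Reg rFail) next_digits (rAns <:- Const 1 ;; rGo <:- Const 0)).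

(** The products in the addresses are computed by repeated addition. The rows of the singletons lie
    in fresh memory, so only their one nonzero cell is written. *)
Definition setup : program :=
  rM <:- Read (Const 1) ;;
  rEta <:- Read (Const 2) ;;
  rStride <:- Reg rM :+ Const 1 ;;
  rAdj <:- Const 3 ;;
  For rX rN (rAdj <:- Reg rAdj :+ Reg rM) ;;
  rUsed <:- Reg rAdj ;;
  For rX rM (rUsed <:- Reg rUsed :+ Reg rM) ;;
  rPrice <:- Reg rUsed :+ Reg rM ;;
  rOwner <:- Reg rPrice :+ Reg rM ;;
  rDigits <:- Reg rOwner :+ Reg rM ;;
  rSingle <:- Reg rDigits :+ Reg rN ;;
  rMark <:- Reg rSingle ;;
  For rX rM (
    M[Reg rMark :+ Reg rX] <:- Const 1 ;;
    rMark <:- Reg rMark :+ Reg rStride) ;;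
  rList <:- Reg rMark :+ Reg rStride.

(** Without agents the empty allocation is a solution, and the time bound leaves no room for an
    enumeration. *)
Definition allocate : program :=
  rN <:- Read (Const 0) ;;
  If (Reg rN) (setup ;; enumerate ;; search) (rAns <:- Const 1).

Ltac run := repeat lazymatch goal with
  | |- wp (Seq _ _) _ _ _ => apply: wp_seq
  | |- wp (Assign _ _) _ _ _ => apply: wp_assign
  | |- wp (Write _ _) _ _ _ => apply: wp_write
  | |- wp Skip _ _ _ => apply: wp_skip
  end; rewrite /= ?/update /=.

Lemma iota_rcons i : iota 0 i.+1 = rcons (iota 0 i) i.
Proof. by rewrite -addn1 iotaD cats1 add0n. Qed.

(** * Memory layout and verification of the enumeration *)

Section Layout.

Variables (n m eta : nat) (U : nat -> nat -> nat) (E : rel nat).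
Variables (adj0 used0 price0 owner0 digits0 single0 mark0 list0 : nat).
Hypothesis used0E : used0 = adj0 + m * m.
Hypothesis adj0E : adj0 = 3 + n * m.
Hypothesis price0E : price0 = used0 + m.
Hypothesis owner0E : owner0 = price0 + m.
Hypothesis digits0E : digits0 = owner0 + m.
Hypothesis single0E : single0 = digits0 + n.
Hypothesis mark0E : mark0 = single0 + m * m.+1.
Hypothesis list0E : list0 = mark0 + m.+1.

Record layout (s : state) : Prop := Layout {
  regN : regs s rN = n;
  regM : regs s rM = m;
  regEta : regs s rEta = eta;
  regStride : regs s rStride = m.+1;
  regAdj : regs s rAdj = adj0;
  regUsed : regs s rUsed = used0;
  regPrice : regs s rPrice = price0;
  regOwner : regs s rOwner = owner0;
  regDigits : regs s rDigits = digits0;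
  regSingle : regs s rSingle = single0;
  regMark : regs s rMark = mark0;
  regList : regs s rList = list0 }.

(** Registers 1 to 12 are those that [layout] describes; for a concrete program the side condition
    is checked by computation. *)
Lemma layout_frame rs s s' :
  same_regs rs s s' -> all (fun r => r \notin rs) (iota 1 12) ->
  layout s -> layout s'.
Proof.
move=> fr /= /and5P[h1 h2 h3 h4 /and5P[h5 h6 h7 h8 /and5P[h9 h10 h11 h12 _]]] l.
by case: l => *; constructor; rewrite fr.
Qed.

Definition inputs (M : nat -> nat) : Prop :=
  (forall a x, a < n -> x < m -> M (3 + a * m + x) = U a x) /\
  (forall x y, x < m -> y < m -> (M (adj0 + x * m + y) != 0) = E x y).

Definition same_below (l : nat) (M M' : nat -> nat) : Prop :=
  forall i, i < l -> M' i = M i.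

Lemma inputs_below M M' : same_below used0 M M' -> inputs M -> inputs M'.
Proof.
move=> below [inU inE]; split=> [a x an xm|x y xm ym]; rewrite below ?inU ?inE //.
  by nia.
by nia.
Qed.

Definition row (M : nat -> nat) (q : nat) (B : seq nat) : Prop :=
  forall y, y < m -> (M (q + y) != 0) = (y \in B).

Definition rows (M : nat -> nat) (q : nat) (Bs : seq (seq nat)) : Prop :=
  forall j, j < size Bs -> row M (q + j * m.+1) (nth [::] Bs j).

Lemma row_below l M M' q B :
  same_below l M M' -> q + m <= l -> row M q B -> row M' q B.
Proof. by move=> below le rq y ym; rewrite below ?rq //; lia. Qed.

Lemma rows_below l M M' q Bs :
  same_below l M M' -> q + size Bs * m.+1 <= l -> rows M q Bs -> rows M' q Bs.
Proof.
move=> below le rq j jB; apply: row_below below _ (rq j jB).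
by apply: leq_trans le; nia.
Qed.

Lemma rows_cat M q Bs Cs :
  rows M q (Bs ++ Cs) <-> rows M q Bs /\ rows M (q + size Bs * m.+1) Cs.
Proof.
split=> [r|[rB rC] j].
  split=> j jB.
    have := r j; rewrite size_cat nth_cat jB => /(_ _); apply.
    exact: leq_trans jB (leq_addr _ _).
  have := r (size Bs + j); rewrite size_cat nth_cat ltn_add2l [_ + _ < size Bs]ltnNge leq_addr /=.
  by rewrite addKn mulnDl addnA; apply.
rewrite size_cat nth_cat => jlt; case: ltnP => jB; first exact: rB.
rewrite -{1}(subnKC jB) mulnDl addnA; apply: rC.
by rewrite ltn_subLR.
Qed.

Lemma wp_extend_row s x B :
  layout s -> inputs (memory s) -> regs s rX = x -> x < m ->
  regs s rAdjRow = adj0 + x * m -> all (gtn m) B ->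
  row (memory s) (regs s rRow) B -> used0 <= regs s rEnd ->
  regs s rRow + m <= regs s rEnd ->
  wp extend_row s (m.+1 * 30 + 20) (fun s' =>
    [/\ same_below (regs s rEnd) (memory s) (memory s'),
        row (memory s') (regs s rEnd) (x :: B) &
        regs s' rEnd = regs s rEnd + (if compatible E x B then m.+1 else 0)]).
Proof.
move=> lay inp rXE xm rAE Bm rB le1 le2.
set e := regs s rEnd in le1 le2 *; set q := regs s rRow in rB le2 *.
have [_ inpE] := inp.
set Q := (X in wp _ _ _ X).
rewrite /extend_row; apply: wp_le; first run.
  pose I i s' := [/\ same_below e (memory s) (memory s'),
    forall y, y < i -> (memory s' (e + y) != 0) = (y \in B) &
    (regs s' rOk != 0) = all (fun y => (y \in B) ==> ~~ E x y) (iota 0 i)].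
  apply: (wp_for (I := I)) => //.
  - move=> i s1; rewrite [regs _ rM]/= /update /= regM // => im iE fr [below rE okE].
    have eE : regs s1 rEnd = e by rewrite fr.
    have qE : regs s1 rRow = q by rewrite fr.
    have aE : regs s1 rAdjRow = adj0 + x * m by rewrite fr.
    have mB : (memory s1 (q + i) != 0) = (i \in B).
      by rewrite below ?rB //; lia.
    have mE : (memory s1 (adj0 + x * m + i) != 0) = E x i.
      by rewrite below ?inpE //; nia.
    have I1 s2 : regs s2 rOk = (if (i \in B) && E x i then 0 else regs s1 rOk) ->
        memory s2 =1 update (memory s1) (e + i) (memory s1 (q + i)) ->
        I i.+1 s2.
      move=> ok2 mem2; split.
      - by move=> j je; rewrite mem2 /update; case: eqP => [|_]; [lia | apply: below].
      - move=> y; rewrite mem2 /update eqn_add2l.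
        by case: (eqVneq y i) => [-> _|yi]; [by rewrite mB | rewrite ltnS => ?; apply: rE; lia].
      - rewrite iota_rcons all_rcons -okE ok2.
        by case: (i \in B) (E x i) => [] []; rewrite ?andbT ?andbF.
    (* The copy is written before the source cell is read again, so the two cells must be distinct,
       and likewise for the adjacency cell. *)
    have qi : (q + i == e + i) = false by lia.
    have ai : (adj0 + x * m + i == e + i) = false by nia.
    run; apply: wp_if; rewrite /= /update eE qE iE qi => h.
      apply: wp_if; rewrite /= /update aE iE ai => h'; run; apply: I1 => //=.
        by rewrite /update /= -mB h -mE h'.
      by rewrite -mB h -mE h'.
    run; apply: I1 => //=.
    by rewrite -mB h.
  - move=> s1 fr; rewrite [regs _ rM]/= /update /= regM // => -[below rE okE].
    have eE : regs s1 rEnd = e by rewrite fr.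
    have xE : regs s1 rX = x by rewrite fr.
    have sE : regs s1 rStride = m.+1 by rewrite fr //; apply: regStride lay.
    have okE' : (regs s1 rOk != 0) = compatible E x B.
      rewrite okE; apply/allP/allP => ok y yP.
        have ym := allP Bm _ yP; have := ok y; rewrite mem_iota /= yP; exact.
      by apply/implyP=> /ok.
    have fin s2 : regs s2 rEnd = e + (if compatible E x B then m.+1 else 0) ->
        memory s2 =1 update (memory s1) (e + x) 1 -> Q s2.
      move=> e2 mem2; split=> //.
      - by move=> j je; rewrite mem2 /update; case: eqP => [|_]; [lia | apply: below].
      - move=> y ym; rewrite mem2 /update eqn_add2l inE.
        by case: (eqVneq y x) => //= _; apply: rE.
    run; apply: wp_if => [h|h]; run; apply: fin => //=; move: h;
      rewrite /= /update /= ?eE ?xE ?sE // => h.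
      by rewrite -okE' h.
    by rewrite -okE' h addn0.
by rewrite /= /update /= (regM lay); lia.
Qed.
(** [B0] is the table written so far. The source rows lie below [rEnd], hence survive the writes
    even when they form an initial part of that table, as in the second pass of a round. *)
Lemma wp_extend_rows lim s x B0 Bs :
  layout s -> inputs (memory s) -> regs s rX = x -> x < m ->
  regs s rAdjRow = adj0 + x * m -> all (all (gtn m)) Bs ->
  lim \notin assigned (extend_rows lim) ->
  regs s lim = regs s rRow + size Bs * m.+1 -> regs s lim <= regs s rEnd ->
  rows (memory s) (regs s rRow) Bs ->
  regs s rEnd = list0 + size B0 * m.+1 -> rows (memory s) list0 B0 ->
  wp (extend_rows lim) s (size Bs * (m.+1 * 30 + 40) + 10) (fun s' =>
    [/\ same_below (regs s rEnd) (memory s) (memory s'),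
        rows (memory s') list0 (B0 ++ extend E x Bs) &
        regs s' rEnd = list0 + size (B0 ++ extend E x Bs) * m.+1]).
Proof.
elim: Bs s B0 => [|B Bs IH] s B0 lay inp xE xm aE Bm limP limE lime rBs endE rL.
  apply: (wp_le (T := 4)) => //.
  apply: wp_while_false; first by rewrite /= limE mul0n addn0 subnn.
  by rewrite cats0; split.
have limr : lim \notin assigned extend_row.
  by apply: contra limP => h; rewrite (_ : assigned _ = assigned extend_row ++ [:: rRow]) // mem_cat h.
have limq : lim != rRow.
  by apply: contra limP => /eqP->.
rewrite /= in limE Bm rBs *; case/andP: Bm => Bm Bsm.
have rB : row (memory s) (regs s rRow) B.
  by have := rBs 0 isT; rewrite mul0n addn0.
apply: (wp_le (T := (3 + (m.+1 * 30 + 20 + 4) +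
  (size Bs * (m.+1 * 30 + 40) + 10)).+1)); last by nia.
have le0 : used0 <= regs s rEnd by nia.
apply: wp_while_true; first by rewrite /= limE; nia.
apply: wp_seq; apply: wp_frame (wp_extend_row lay inp xE xm aE Bm rB le0 _) (leqnn _) _.
  by nia.
move=> s1 fr [below rowB endE1]; apply: (wp_assign (e := Reg rRow :+ Reg rStride)).
set s2 := set_reg _ _ _.
have qE : regs s2 rRow = regs s rRow + m.+1.
  by rewrite /= /update /= !fr // (regStride lay).
have lay2 : layout s2.
  by case: (layout_frame fr isT lay); constructor.
have lim2 : regs s2 lim = regs s lim by rewrite /= /update (negPf limq) fr.
have end2 : regs s rEnd <= regs s2 rEnd by rewrite /= /update /= endE1 leq_addr.
have rs2 : regs s2 rEnd = list0 + size (B0 ++ extend E x [:: B]) * m.+1.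
  rewrite /= /update /= endE1 endE /extend /=.
  by case: compatible; rewrite /= ?cats0 ?size_cat /=; lia.
apply: wp_mono (IH s2 (B0 ++ extend E x [:: B]) _ _ _ _ _ _ _ _ _ _ _ _) (leqnn _) _ => //.
- by apply: inputs_below inp; move=> i il; apply: below; apply: leq_trans il le0.
- by rewrite /= /update /= fr.
- by rewrite /= /update /= fr.
- by rewrite lim2 qE limE; lia.
- by rewrite lim2; apply: leq_trans end2.
- rewrite qE; apply: rows_below below _ _; first by move: lime; rewrite limE; lia.
  move=> j jB; have := rBs j.+1 jB; rewrite mulSn addnA; exact.
- apply/rows_cat; split.
    by apply: rows_below below _ rL; rewrite endE.
  rewrite /extend /=; case: compatible => //= -[|j] //= _.
  by rewrite mul0n addn0 -endE.
- move=> s3 [below3]; rewrite -catA => r3 e3; split.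
  + by move=> i il; rewrite below3 ?below //; apply: leq_trans il end2.
  + by move: r3; rewrite /extend /=; case: compatible.
  + by move: e3; rewrite /extend /=; case: compatible.
Qed.

Lemma wp_enumerate s :
  layout s -> inputs (memory s) -> rows (memory s) single0 (singletons m) ->
  wp enumerate s
    (m.+1 * (m.+1 * (m.+1 * 30 + 40) + size (bundles E m) * (m.+1 * 30 + 40) + 50) + 10)
    (fun s' => [/\ same_below list0 (memory s) (memory s'),
      rows (memory s') list0 (bundles E m) &
      regs s' rEnd = list0 + size (bundles E m) * m.+1]).
Proof.
move=> lay inp rS; set Q := (X in wp _ _ _ X).
rewrite /enumerate; apply: wp_le; first run.
  pose I x s' := [/\ same_below list0 (memory s) (memory s'),
    rows (memory s') list0 (bundles E x),
    regs s' rEnd = list0 + size (bundles E x) * m.+1,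
    regs s' rAdjRow = adj0 + x * m & regs s' rSingleEnd = single0 + x * m.+1].
  pose c := m.+1 * 30 + 40.
  apply: (wp_for (I := I) (B := m * c + 10 + (size (bundles E m) * c + 10) + 30)) => //.
  - split=> //=.
    + by rewrite /update /= (regList lay) addn0.
    + by rewrite /update /= (regAdj lay) addn0.
    + by rewrite /update /= (regSingle lay) addn0.
  - move=> x s1; rewrite [regs _ rM]/= /update /= (regM lay) => xm xE fr.
    move=> [below rL endE aE sE].
    have lay1 : layout s1.
      by apply: layout_frame (fr) isT _; first by case: lay; constructor.
    have lt i : i < used0 -> i < list0 by nia.
    have inp1 : inputs (memory s1).
      by apply: inputs_below inp => i /lt; apply: below.
    apply: wp_le; first run.
      set s2 := set_reg _ _ _.
      have rS2 : rows (memory s2) single0 (singletons x).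
        move=> j; rewrite size_map size_iota => jx.
        have := rS j; rewrite size_map size_iota => /(_ (ltn_trans jx xm)).
        rewrite /singletons !(nth_map 0) ?size_iota ?nth_iota ?(ltn_trans jx xm) //.
        by apply: row_below below _; nia.
      have q2 : regs s2 rRow = single0 by rewrite /= /update /= (regSingle lay1).
      apply: wp_frame (wp_extend_rows (s := s2) (x := x) (B0 := bundles E x)
        (Bs := singletons x) _ _ _ _ _ _ _ _ _ _ _ _) (leqnn _) _ => //.
      - by case: lay1; constructor.
      - apply/allP=> B /mapP[y]; rewrite mem_iota /= => yx ->.
        by rewrite /= andbT; apply: ltn_trans yx xm.
      - by rewrite q2 size_map size_iota.
      - by rewrite /= /update /= sE endE; nia.
      - by rewrite q2.
      move=> s3 fr3 [below3 rL3 endE3].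
      have lay3 : layout s3.
        by apply: layout_frame fr3 isT _; case: lay1; constructor.
      have inp3 : inputs (memory s3).
        apply: inputs_below inp1 => i il; apply: below3.
        by rewrite /= /update /= endE; have := lt i il; lia.
      run; set s4 := set_reg _ _ _.
      apply: wp_frame (wp_extend_rows (s := s4) (x := x)
        (B0 := bundles E x ++ extend E x (singletons x))
        (Bs := bundles E x) _ _ _ _ _ _ _ _ _ _ _ _) (leqnn _) _ => //.
      - by case: lay3; constructor.
      - by rewrite /= /update /= fr3.
      - by rewrite /= /update /= fr3.
      - apply/allP=> B; rewrite mem_bundles => /and4P[_ _ Bx _].
        by apply: sub_all Bx => y /= yx; apply: ltn_trans yx xm.
      - by rewrite /= /update /= fr3 //= (regList lay3) /update /= endE.
      - rewrite /= /update /= fr3 //= endE3 /update /= endE size_cat; nia.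
      - rewrite [regs s4 _](regList lay3).
        apply: rows_below below3 _ _ => //.
        by rewrite /= /update /= endE.
      move=> s5 fr5 [below5 rL5 endE5].
      have lay5 : layout s5.
        by apply: layout_frame fr5 isT _; case: lay3; constructor.
      (* Two passes over separate lists amount to one pass over their concatenation, which is the
         recursive step of [bundles]. *)
      have bundlesE : (bundles E x ++ extend E x (singletons x)) ++
          extend E x (bundles E x) = bundles E x.+1.
        by rewrite /= -catA /extend -map_cat -filter_cat.
      run; split.
      - move=> i il; rewrite -below // -[RHS]below3; last first.
          by rewrite /= /update /= endE; lia.
        rewrite -[RHS]below5 //= /update /= endE3; lia.
      - by rewrite -bundlesE.
      - by rewrite /= /update /= endE5 bundlesE.
      - by rewrite /= /update /= fr5 //= /update /= fr3 //= (regM lay5) /update /= aE; lia.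
      - by rewrite /= /update /= fr5 //= /update /= fr3 //= (regStride lay5) /update /= sE; lia.
    rewrite /= size_map size_iota -/c.
    have h1 : x * c <= m * c by rewrite leq_mul2r (ltnW xm) orbT.
    have h2 : size (bundles E x) * c <= size (bundles E m) * c.
      by rewrite leq_mul2r leq_size_bundles ?orbT // ltnW.
    lia.
  - move=> s1 fr; rewrite [regs _ rM]/= /update /= (regM lay) => -[below rL endE _ _].
    by split.
rewrite /= /update /= (regM lay); nia.
Qed.

Definition same_outside (l h : nat) (M M' : nat -> nat) : Prop :=
  forall i, (i < l) || (h <= i) -> M' i = M i.

Lemma same_outside_trans l h M M' M'' :
  same_outside l h M M' -> same_outside l h M' M'' -> same_outside l h M M''.
Proof. by move=> h1 h2 i il; rewrite h2 ?h1. Qed.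

Lemma same_outside_sub l h l' h' M M' : l' <= l -> h <= h' ->
  same_outside l h M M' -> same_outside l' h' M M'.
Proof. by move=> ll hh o i il; apply: o; lia. Qed.

Lemma wp_clear_items s : layout s ->
  wp clear_items s (m.+1 * 23) (fun s' =>
    same_outside used0 digits0 (memory s) (memory s') /\
    (forall x, x < m -> [/\ memory s' (used0 + x) = 0, memory s' (price0 + x) = 0
       & memory s' (owner0 + x) = 0])).
Proof.
move=> lay; set Q := (X in wp _ _ _ X).
rewrite /clear_items; apply: wp_le.
  pose I i s' := same_outside used0 digits0 (memory s) (memory s') /\
    (forall x, x < i -> [/\ memory s' (used0 + x) = 0, memory s' (price0 + x) = 0
       & memory s' (owner0 + x) = 0]).
  apply: (wp_for (I := I) (B := 15)) => //.
  - move=> i s1; rewrite (regM lay) => im iE fr [out zero].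
    have lay1 : layout s1 by apply: layout_frame fr isT _; case: lay; constructor.
    apply: wp_le; first run => //.
    rewrite iE (regUsed lay1) (regPrice lay1) (regOwner lay1); split=> /=.
      move=> j jl; have := out j jl; rewrite /update.
      by do 3![case: eqP => [?|_]; first by lia].
    move=> x; rewrite ltnS leq_eqVlt => xi; rewrite /update !eqn_add2l.
    have [->|xi'] := eqVneq x i; first by split; rewrite ?eqxx //; do ?case: eqP.
    have /zero[-> -> ->] : x < i by lia.
      by split; do ?case: eqP.
    by [].
  - by move=> s1 fr; rewrite (regM lay).
by rewrite (regM lay).
Qed.

(** * Testing a single word *)

Section Word.

Variable w : seq nat.

(** The list in front makes letter 0 denote the empty bundle, so agents with a single job reserve
    nothing before the auction. *)
Let bundle (a : nat) : seq nat := nth [::] ([::] :: bundles E m) (nth 0 w a).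

(** The memory holds the word [w], whose letter [d] stands for the row [d] of the
    table at [mark0]: the letter 0 for a single job, [d > 0] for the [d]-th
    bundle. *)
Definition digits (M : nat -> nat) : Prop :=
  forall a, a < n -> M (digits0 + a) = mark0 + nth 0 w a * m.+1.

Definition utility (a : nat) (B : seq nat) (k : nat) : nat :=
  \sum_(x <- iota 0 k | x \in B) U a x.

(** Disjointness is stated for [a < b] because the program compares each bundle with those of the
    earlier agents. *)
Definition bundles_ok (k : nat) : Prop :=
  (forall a, a < k -> nth 0 w a != 0 -> eta <= utility a (bundle a) m) /\
  (forall a b x, a < b -> b < k -> x < m -> x \in bundle a -> x \notin bundle b).

(** Each job is visited once and its cell is read before it is marked, so a bundle never conflicts
    with its own marks and the condition can refer to the memory of [s]. *)
Lemma wp_check_bundle s a B :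
  layout s -> inputs (memory s) -> a < n -> regs s rUtil = 3 + a * m ->
  row (memory s) (regs s rDigit) B -> price0 <= regs s rDigit ->
  wp check_bundle s (m.+1 * 40 + 10) (fun s' =>
    [/\ same_outside used0 price0 (memory s) (memory s'),
      forall x, x < m -> (memory s' (used0 + x) != 0)
        = (memory s (used0 + x) != 0) || (x \in B) &
      regs s' rFail = 0 <-> [/\ regs s rFail = 0,
         forall x, x < m -> x \in B -> memory s (used0 + x) = 0
         & eta <= utility a B m]]).
Proof.
move=> lay inp an uE rB dge; set Q := (X in wp _ _ _ X).
have [inpU _] := inp.
rewrite /check_bundle; apply: wp_le; first run.
  pose I i s' := [/\ same_outside used0 price0 (memory s) (memory s'),
      regs s' rSum = utility a B i,
      forall x, x < m -> (memory s' (used0 + x) != 0)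
        = (memory s (used0 + x) != 0) || (x < i) && (x \in B) &
      regs s' rFail = 0 <-> regs s rFail = 0 /\
         forall x, x < i -> x \in B -> memory s (used0 + x) = 0].
  apply: (wp_for (I := I) (B := 30)) => //.
  - split=> //=; first by rewrite /utility big_nil.
      by move=> x xm; rewrite orbF.
    by rewrite /update /=; split=> // -[].
  - move=> i s1; rewrite [regs _ rM](regM lay) => im iE fr [out sE uE1 fE].
    have lay1 : layout s1 by apply: layout_frame fr isT _; case: lay; constructor.
    have uE' : regs s1 rUtil = 3 + a * m by rewrite fr.
    have dE : regs s1 rDigit = regs s rDigit by rewrite fr.
    have mB : (memory s1 (regs s rDigit + i) != 0) = (i \in B).
      by rewrite out ?rB //; lia.
    have mU : memory s1 (3 + a * m + i) = U a i.
      by rewrite out ?inpU //; nia.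
    apply: wp_le; first (apply: wp_if; rewrite /= dE iE => h).
    + run; rewrite ?iE ?uE' ?mU /= ?(regUsed lay1).
      have iB : i \in B by rewrite -mB h.
      split=> /=.
      * by move=> j jl; have := out j jl; rewrite /update; case: eqP => // ?; lia.
      * by rewrite /update /= sE /utility iota_rcons big_rcons /= iB addnC.
      * move=> x xm; rewrite /update eqn_add2l; case: (eqVneq x i) => [->|xi].
          by rewrite iB ltnSn orbT.
        by rewrite uE1 // ltnS [x <= i]leq_eqVlt (negPf xi).
      * have ui := uE1 i im; rewrite ltnn orbF in ui.
        rewrite /update /=; split.
          move=> f0; have [f1 u1] : regs s1 rFail = 0 /\ memory s1 (used0 + i) = 0 by lia.
          have [fs us] := fE.1 f1; split=> // x; rewrite ltnS leq_eqVlt.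
          case/predU1P=> [-> _|]; last exact: us.
          by apply/eqP; rewrite -[_ == _]negbK -ui u1.
        move=> [f0 us]; rewrite (fE.2 _) ?add0n.
          by apply/eqP; rewrite -[_ == _]negbK ui us.
        by split=> // x xi; apply: us; apply: leqW.
    + run.
      have iB : i \in B = false by rewrite -mB h.
      split=> //=.
      * by rewrite /update /= sE /utility iota_rcons big_rcons iB /= addn0.
      * move=> x xm; rewrite uE1 // ltnS [x <= i]leq_eqVlt.
        by case: (eqVneq x i) => // ->; rewrite iB !andbF.
      * rewrite /update /= fE; split=> -[f0 us]; split=> // x xi.
          move: xi; rewrite ltnS leq_eqVlt => /predU1P[->|]; first by rewrite iB.
          exact: us.
        by apply: us; apply: leqW.
    by [].
  - move=> s1 fr; rewrite [regs _ rM](regM lay) => -[out sE uE1 fE].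
    have lay1 : layout s1 by apply: layout_frame fr isT _; case: lay; constructor.
    run; rewrite (regEta lay1) sE; split=> //=.
      by move=> x xm; rewrite uE1 // xm.
    rewrite /update /=; split.
      by move=> f0; have [|f1 us] := fE.1 _; [lia | split=> //; lia].
    by move=> [f0 us le]; rewrite (fE.2 _) ?add0n //; apply/eqP.
by rewrite /= /update /= (regM lay); lia.
Qed.

Lemma wp_check_bundles s :
  layout s -> inputs (memory s) -> digits (memory s) ->
  rows (memory s) list0 (bundles E m) ->
  (forall a, a < n -> nth 0 w a <= size (bundles E m)) ->
  regs s rFail = 0 -> (forall x, x < m -> memory s (used0 + x) = 0) ->
  wp check_bundles s (n.+1 * (m.+1 * 40 + 40) + 10) (fun s' =>
    [/\ same_outside used0 price0 (memory s) (memory s'),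
      forall x, x < m -> (memory s' (used0 + x) != 0)
        = has (fun a => x \in bundle a) (iota 0 n) &
      regs s' rFail = 0 <-> bundles_ok n]).
Proof.
move=> lay inp dig rL wK f0 u0; set Q := (X in wp _ _ _ X).
rewrite /check_bundles; apply: wp_le; first run.
  pose I i s' := [/\ same_outside used0 price0 (memory s) (memory s'),
      regs s' rUtil = 3 + i * m,
      forall x, x < m -> (memory s' (used0 + x) != 0)
        = has (fun a => x \in bundle a) (iota 0 i) &
      regs s' rFail = 0 <-> bundles_ok i].
  apply: (wp_for (I := I) (B := m.+1 * 40 + 30)) => //.
  - by split=> //=; move=> x xm; rewrite u0.
  - move=> i s1; rewrite [regs _ rN](regN lay) => iN iE fr [out uE usedE fE].
    have lay1 : layout s1 by apply: layout_frame fr isT _; case: lay; constructor.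
    have inp1 : inputs (memory s1).
      by apply: inputs_below inp => j jl; apply: out; rewrite jl.
    have dE : memory s1 (digits0 + i) = mark0 + nth 0 w i * m.+1.
      by rewrite out ?dig //; lia.
    have hasS x : has (fun a => x \in bundle a) (iota 0 i.+1) =
        has (fun a => x \in bundle a) (iota 0 i) || (x \in bundle i).
      by rewrite iota_rcons has_rcons orbC.
    apply: wp_le; first run.
      apply: wp_if; rewrite /= /update /= iE (regDigits lay1) dE (regMark lay1) addKn => h.
      + have wi : nth 0 w i != 0 by move: h; rewrite muln_eq0 orbF.
        set s2 := set_reg _ _ _.
        have rB : row (memory s2) (regs s2 rDigit) (bundle i).
          move=> y ym; have wKi := wK i iN.
          rewrite /bundle -(prednK (n := nth 0 w i)) ?lt0n //=.
          rewrite -(rL (nth 0 w i).-1 _ y ym) ?out; last by lia.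
            by rewrite /= /update /=; congr (memory s _ != 0); nia.
          by rewrite /= /update /=; nia.
        apply: wp_frame (wp_check_bundle (s := s2) (a := i) (B := bundle i) _ _ _ _ _ _)
          (leqnn _) _ => //.
        * by case: lay1; constructor.
        * by rewrite /= /update /=; nia.
        move=> s3 fr3 [out3 used3 fail3].
        run; split.
        * exact: same_outside_trans out out3.
        * by rewrite /= /update /= !fr3 //= /update /= uE (regM lay1); lia.
        * by move=> x xm; rewrite hasS -usedE //; apply: used3.
        * rewrite [regs _ rFail]/= /update /= fail3; split.
            move=> [/fE[ok1 ok2] us le]; split.
              move=> a; rewrite ltnS leq_eqVlt => /predU1P[-> //|]; exact: ok1.
            move=> a b x ab bi; move: bi ab.
            rewrite ltnS leq_eqVlt => /predU1P[-> ab xm xa|bi ab]; last exact: ok2.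
            (* A marked job is one that lies in the bundle of some earlier agent. *)
            apply/negP=> xb; have := usedE x xm; rewrite us // => /esym/hasPn/(_ a).
            by rewrite mem_iota => /(_ ab) /negP; apply.
          move=> [ok1 ok2]; split; last by apply: ok1.
            apply/fE; split=> [a ai|a b x ab bi]; first by apply: ok1; apply: leqW.
            by apply: ok2 => //; apply: leqW.
          move=> x xm xB; apply/eqP; rewrite -[_ == _]negbK usedE //.
          apply/hasPn=> a; rewrite mem_iota /= => ai.
          by apply/negP=> xa; have /negP := ok2 a i x ai (ltnSn _) xm xa; apply.
      + have wi : nth 0 w i = 0 by lia.
        have bi : bundle i = [::] by rewrite /bundle wi.
        run; split=> //.
        * by rewrite /= /update /= uE (regM lay1); lia.
        * by move=> x xm; rewrite hasS bi orbF; apply: usedE.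
        * rewrite [regs _ rFail]/= /update /= fE; split=> -[ok1 ok2]; split.
          - move=> a; rewrite ltnS leq_eqVlt => /predU1P[->|]; [by rewrite wi | exact: ok1].
          - move=> a b x ab; rewrite ltnS leq_eqVlt => /predU1P[->|]; last exact: ok2 ab.
            by rewrite bi.
          - by move=> a ai; apply: ok1; apply: leqW.
          - by move=> a b x ab bi'; apply: ok2 => //; apply: leqW.
    rewrite /=; lia.
  - by move=> s1 fr; rewrite [regs _ rN](regN lay) => -[out _ usedE fE].
by rewrite /= /update /= (regN lay); lia.
Qed.

Let single (a : nat) : bool := nth 0 w a == 0.

Let acc (a x : nat) : bool :=
  ~~ has (fun b => x \in bundle b) (iota 0 n) && (eta <= U a x).

(** The utility row of agent [a] starts after three header cells; the offset keeps the code of an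
    owner different from 0, the code of a free job. *)
Definition encode_owner (o : option nat) : nat := if o is Some a then 3 + a * m else 0.

Definition used_ok (M : nat -> nat) : Prop :=
  forall x, x < m -> (M (used0 + x) != 0) = has (fun a => x \in bundle a) (iota 0 n).

Definition auction_state (M : nat -> nat) (p : nat -> nat) (o : nat -> option nat) :=
  forall x, x < m -> M (price0 + x) = p x /\ M (owner0 + x) = encode_owner (o x).

Lemma wp_find_cheapest s p o c :
  layout s -> inputs (memory s) -> used_ok (memory s) ->
  auction_state (memory s) p o -> c < n -> regs s rCur = 3 + c * m ->
  wp find_cheapest s (m.+1 * 40 + 10) (fun s' =>
    [/\ memory s' = memory s,
      regs s' rItem = 0 -> forall y, y < m -> acc c y -> n <= p y &
      regs s' rItem != 0 -> let x := (regs s' rItem).-1 in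
        [/\ x < m, acc c x, p x = regs s' rBest, p x < n
          & forall y, y < m -> acc c y -> p x <= p y]]).
Proof.
move=> lay inp used st cn cE; set Q := (X in wp _ _ _ X).
have [inpU _] := inp.
rewrite /find_cheapest; apply: wp_le; first run.
  pose I i s' :=
    [/\ memory s' = memory s,
      forall y, y < i -> acc c y -> regs s' rBest <= p y,
      regs s' rItem = 0 -> regs s' rBest = n &
      regs s' rItem != 0 -> let x := (regs s' rItem).-1 in
        [/\ x < m, acc c x, p x = regs s' rBest & p x < n]].
  apply: (wp_for (I := I) (B := 32)) => //.
  - by split; rewrite // /= /update /= (regN lay).
  - move=> i s1; rewrite [regs _ rM](regM lay) => im iE fr [memE best item0 item1].
    have lay1 : layout s1 by apply: layout_frame fr isT _; case: lay; constructor.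
    have cE1 : regs s1 rCur = 3 + c * m by rewrite fr.
    have [pE _] := st i im.
    have accE : acc c i = (memory s (used0 + i) == 0) && (eta <= U c i).
      by rewrite /acc -used // negbK.
    have skip s2 : memory s2 = memory s -> regs s2 rBest = regs s1 rBest ->
        regs s2 rItem = regs s1 rItem -> (acc c i -> regs s1 rBest <= p i) ->
        I i.+1 s2.
      move=> m2 b2 i2 le2; split=> //; rewrite ?b2 ?i2 //.
      move=> y; rewrite ltnS leq_eqVlt => /predU1P[->|]; [exact: le2 | exact: best].
    apply: wp_le; first (apply: wp_if; rewrite /= memE (regUsed lay1) iE => h).
    + by run; apply: skip => //=; rewrite accE (negPf h).
    + apply: wp_if; rewrite /= memE (regEta lay1) cE1 iE inpU // => h1.
        by run; apply: skip => //=; rewrite accE h leqNgt; lia.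
      have ai : acc c i by rewrite accE h; lia.
      apply: wp_if; rewrite /= memE (regPrice lay1) iE pE => h2.
        run; rewrite memE (regPrice lay1) iE pE; split=> //=.
        * by move=> y; rewrite /update /= ltnS leq_eqVlt => /predU1P[->//|yi] /best-/(_ yi); lia.
        * by rewrite /update /= addn1.
        * rewrite /update /= addn1 /= => _; split=> //.
          have [z|nz] := eqVneq (regs s1 rItem) 0; first by have := item0 z; lia.
          by have [_ _ e lt] := item1 nz; lia.
      by run; apply: skip => //= _; lia.
    by [].
  - move=> s1 fr; rewrite [regs _ rM](regM lay) => -[memE best item0 item1].
    split=> //; first by move=> z y ym /best; rewrite item0 //; apply.
    by move=> /item1[xm xa xp xn]; split=> //; rewrite xp.
by rewrite /= /update /= (regM lay); lia.
Qed.

(** The variant is one more than the sum of [n - p x] over all jobs [x], and 0 once nobody is in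
    hand. A nonzero [rFail] is a certificate: it is set only where [auction_stuck] excludes a
    matching. *)
Lemma wp_insert_agent s p o c :
  layout s -> inputs (memory s) -> used_ok (memory s) ->
  auction_state (memory s) p o -> auction_inv n m acc single p o ->
  c < n -> single c -> ~ owned m o c -> regs s rCur = 3 + c * m ->
  wp insert_agent s ((n * m).+2 * (m.+1 * 40 + 100)) (fun s' =>
    exists p' o', [/\ same_outside price0 digits0 (memory s) (memory s'),
      auction_state (memory s') p' o', auction_inv n m acc single p' o',
      forall b, owned m o' b -> owned m o b \/ b = c &
      (regs s' rFail = 0 -> regs s rFail = 0 /\
        forall b, owned m o b \/ b = c -> owned m o' b) /\
      (regs s' rFail <> 0 ->
        regs s rFail <> 0 \/ ~ exists f, matching n m acc single f)]).
Proof.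
move=> lay inp used st0 inv0 cn sc nown cE; set Q := (X in wp _ _ _ X).
rewrite /insert_agent.
(* [cur] is the agent in hand. Until a failure, the owners together with [cur] are the old owners
   together with [c]; after a failure only one inclusion remains. *)
pose I k s' := exists p' o' cur,
  [/\ layout s', same_outside price0 digits0 (memory s) (memory s'),
    auction_state (memory s') p' o' /\ auction_inv n m acc single p' o',
    regs s' rCur = encode_owner cur &
    [/\ if cur is Some b then [/\ b < n, single b & ~ owned m o' b] else True,
      (if cur is None then 0 else (\sum_(x < m) (n - p' x)).+1) <= k,
      forall b, owned m o' b \/ cur = Some b -> owned m o b \/ b = c,
      regs s' rFail = 0 -> regs s rFail = 0 /\
        forall b, owned m o b \/ b = c -> owned m o' b \/ cur = Some b &
      regs s' rFail <> 0 ->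
        regs s rFail <> 0 \/ ~ exists f, matching n m acc single f]].
apply: wp_le; first apply: (wp_while (I := I) (B := m.+1 * 40 + 60) (k := (n * m).+1)).
- exists p, o, (Some c); split=> //; split=> //.
  + rewrite ltnS -[m in n * m]card_ord mulnC -sum_nat_const.
    by apply: leq_sum => x _; apply: leq_subr.
  + by move=> b [|[->]]; [left | right].
  + by move=> f0; split=> // b [|->]; [left | right].
  + by left.
- move=> k s1 [p1 [o1 [[b|] [lay1 out1 [st1 inv1] curE [curP kP sub f0 f1]]]]]; last first.
    by rewrite /= curE.
  move=> _; have [bn sb nb] := curP.
  have inp1 : inputs (memory s1).
    by apply: inputs_below inp => j jl; apply: out1; lia.
  have used1 : used_ok (memory s1).
    by move=> x xm; rewrite out1 ?used //; lia.
  apply: wp_le; first apply: wp_seq.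
    apply: wp_frame (wp_find_cheapest lay1 inp1 used1 st1 bn curE) (leqnn _) _.
    move=> s2 fr2 [mem2 none some].
    have lay2 : layout s2 by apply: layout_frame fr2 isT lay1.
    have f2 : regs s2 rFail = regs s1 rFail by rewrite fr2.
    have c2 : regs s2 rCur = 3 + b * m by rewrite fr2.
    apply: wp_if => /= h.
    + have [xm ax px pn best] := some h.
      set x := (regs s2 rItem).-1 in xm ax px pn best.
      run; rewrite subn1 -/x (regPrice lay2) (regOwner lay2) c2 /update /= mem2.
      have -> : (owner0 + x == price0 + x) = false by lia.
      have [_ oE] := st1 x xm; rewrite oE.
      pose p' y := if y == x then (p1 x).+1 else p1 y.
      pose o' y := if y == x then Some b else o1 y.
      have [inv2 keep ob noo] := auction_step (p' := p') (o' := o') inv1 bn sb nb xm ax pn best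
        (fun=> erefl) (fun=> erefl).
      (* The price of [x] was below [n], so the bid lowers the sum by one; a job without owner ends
         the loop. *)
      exists (if o1 x is None then 0 else (\sum_(y < m) (n - p' y)).+1).
        apply: leq_trans kP; case: (o1 x) => // _.
        rewrite ltnS (bigD1 (Ordinal xm)) //= [X in _ < X](bigD1 (Ordinal xm)) //=.
        rewrite {1}/p' eqxx -addSn leq_add //; first lia.
        apply: leq_sum => y yx; rewrite /p' ifN // .
      exists p', o', (o1 x); split=> //=.
      * by case: lay2; constructor.
      * move=> j jl; rewrite /update.
        do 2![case: eqP => [?|_]; first by lia].
        by rewrite ?mem2 out1.
      * split=> // y ym; rewrite /update !eqn_add2l /p' /o' ?mem2.
        have [py oy] := st1 y ym.
        have -> : (owner0 + y == price0 + x) = false by lia.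
        have -> : (price0 + y == owner0 + x) = false by lia.
        have [_|_] := eqVneq y x; last by split.
        by rewrite px addn1.
      split=> //.
      * case ox: (o1 x) => [d|] //.
        have [own _ _ _] := inv1; have [dn sd _] := own x d xm ox.
        by split=> //; apply: noo.
      * move=> d [[y ym]|oxd].
          rewrite /o'; case: eqP => [_ [<-]|_ oy]; apply: sub; [by right | left].
          by exists y.
        by apply: sub; left; exists x.
      * rewrite /= /update /= f2 => /f0[? all1]; split=> // d /all1[od|[<-]]; last by left.
        have [oxd|oxd] := eqVneq (o1 x) (Some d); first by right.
        by left; apply: keep => //; apply/eqP.
      * by rewrite /= /update /= f2.
    + run; exists 0; first by apply: leq_trans kP.
      exists p1, o1, None; split=> //=.
      * by case: lay2; constructor.
      * by rewrite mem2.
      * by rewrite mem2.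
      split=> //; first by move=> d [|//] od; apply: sub; left.
      move=> _; right; apply: auction_stuck inv1 bn sb nb (none h).
  rewrite /=; lia.
- move=> k s1 [p1 [o1 [[b|] [lay1 out1 [st1 inv1] curE [curP kP sub f0 f1]]]]].
    by rewrite /= curE.
  move=> _; exists p1, o1; split=> //; first by move=> b ob; apply: sub; left.
  by split=> // /f0[? all1]; split=> // b /all1[].
by rewrite /=; nia.
Qed.

Lemma wp_auction s p o :
  layout s -> inputs (memory s) -> used_ok (memory s) -> digits (memory s) ->
  auction_state (memory s) p o -> auction_inv n m acc single p o ->
  (forall b, ~ owned m o b) ->
  wp auction s (n.+1 * ((n * m).+2 * (m.+1 * 40 + 100) + 40)) (fun s' =>
    same_outside price0 digits0 (memory s) (memory s') /\
    (regs s' rFail = 0 <->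
       regs s rFail = 0 /\ exists f, matching n m acc single f)).
Proof.
move=> lay inp used dig st inv nown; set Q := (X in wp _ _ _ X).
rewrite /auction; apply: wp_le; first run.
  pose I i s' := [/\ same_outside price0 digits0 (memory s) (memory s'),
    regs s' rUtil = 3 + i * m &
    exists p' o', [/\ auction_state (memory s') p' o', auction_inv n m acc single p' o',
      forall b, owned m o' b -> b < i,
      regs s' rFail = 0 -> regs s rFail = 0 /\
        forall b, b < i -> single b -> owned m o' b &
      regs s' rFail <> 0 ->
        regs s rFail <> 0 \/ ~ exists f, matching n m acc single f]].
  apply: (wp_for (I := I) (B := (n * m).+2 * (m.+1 * 40 + 100) + 20)) => //.
  - split=> //; exists p, o; split=> //; first by move=> b /nown.
    by left.
  - move=> i s1; rewrite [regs _ rN](regN lay) => iN iE fr.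
    move=> [out uE [p1 [o1 [st1 inv1 lt1 f0 f1]]]].
    have lay1 : layout s1 by apply: layout_frame fr isT _; case: lay; constructor.
    have inp1 : inputs (memory s1).
      by apply: inputs_below inp => j jl; apply: out; lia.
    have used1 : used_ok (memory s1).
      by move=> x xm; rewrite out ?used //; lia.
    have dE : memory s1 (digits0 + i) = mark0 + nth 0 w i * m.+1.
      by rewrite out ?dig //; lia.
    apply: wp_le; first apply: wp_seq.
      apply: wp_if; rewrite /= iE (regDigits lay1) dE (regMark lay1) addKn => h.
      + run; split=> //=; first by rewrite /update /= uE (regM lay1); lia.
        exists p1, o1; split=> //; first by move=> b /lt1; apply: leqW.
        move=> /f0[? all1]; split=> // b; rewrite ltnS leq_eqVlt => /predU1P[->|]; last exact: all1.
        by rewrite /single => /eqP wi; rewrite wi in h.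
      + have wi : single i by rewrite /single; lia.
        run; set s2 := set_reg _ _ _.
        have lay2 : layout s2 by case: lay1; constructor.
        have ni : ~ owned m o1 i by move=> /lt1; rewrite ltnn.
        apply: wp_frame (wp_insert_agent (s := s2) (p := p1) (o := o1) (c := i)
          lay2 _ _ _ _ _ _ _ _) (leqnn _) _ => //.
        move=> s3 fr3 [p3 [o3 [out3 st3 inv3 sub [f30 f31]]]].
        have lay3 := layout_frame fr3 isT lay2.
        run; split=> //.
        * exact: same_outside_trans out out3.
        * by rewrite /= /update /= (regM lay3) fr3 //= /update /= uE; lia.
        exists p3, o3; split=> //.
        * by move=> b /sub[/lt1|->//]; apply: leqW.
        * move=> /f30[/f0[? all1] all3]; split=> // b.
          rewrite ltnS leq_eqVlt => /predU1P[-> _|bi sb]; apply: all3; first by right.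
          by left; apply: all1.
        * by move=> /f31[/f1|]; [|right].
    rewrite /=; lia.
  - move=> s1 fr; rewrite [regs _ rN](regN lay) => -[out _ [p1 [o1 [st1 inv1 lt1 f0 f1]]]].
    (* If a matching exists, a nonzero [rFail] would contradict its certificate. If [rFail] is zero,
       every agent with a single job owns one, and the owner table yields the matching. *)
    split=> //; split=> [/f0[? all1]|[z ex]]; last first.
      by have [//|/eqP nz] := eqVneq (regs s1 rFail) 0; case: (f1 nz).
    split=> //; have [own _ inj _] := inv1.
    pose f a := find (fun x => o1 x == Some a) (iota 0 m).
    have fP a : a < n -> single a -> f a < m /\ o1 (f a) = Some a.
      move=> an sa; have [x xm ox] := all1 a an sa.
      have hx : has (fun x => o1 x == Some a) (iota 0 m).
        by apply/hasP; exists x; rewrite ?mem_iota // ox.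
      have fm : f a < m by rewrite -[X in _ < X](size_iota 0) -has_find.
      by split=> //; have /eqP := nth_find 0 hx; rewrite nth_iota.
    exists f; split=> [a an sa|a b an bn sa sb fab].
      by have [fm ofa] := fP a an sa; have [_ _ [? _]] := own _ _ fm ofa.
    have [_ oa] := fP a an sa; have [_ ob] := fP b bn sb.
    by move: oa; rewrite fab ob => -[].
by rewrite /= /update /= (regN lay); lia.
Qed.

Definition good_word : Prop :=
  bundles_ok n /\ exists f, matching n m acc single f.

Lemma wp_check_word s :
  layout s -> inputs (memory s) -> digits (memory s) ->
  rows (memory s) list0 (bundles E m) ->
  (forall a, a < n -> nth 0 w a <= size (bundles E m)) ->
  wp check_word s
    (n.+1 * ((n * m).+2 * (m.+1 * 40 + 100) + m.+1 * 40 + 80) + m.+1 * 23 + 20) (fun s' =>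
    same_outside used0 digits0 (memory s) (memory s') /\
    (regs s' rFail = 0 <-> good_word)).
Proof.
move=> lay inp dig rL wK; set Q := (X in wp _ _ _ X).
rewrite /check_word; apply: wp_le; first run.
  set s0 := set_reg _ _ _.
  have lay0 : layout s0 by case: lay; constructor.
  apply: wp_frame (wp_clear_items lay0) (leqnn _) _ => s1 fr1 [out1 zero].
  have lay1 := layout_frame fr1 isT lay0.
  have inp1 : inputs (memory s1).
    by apply: inputs_below inp => j jl; rewrite out1 ?jl.
  have dig1 : digits (memory s1).
    by move=> a an; rewrite out1 ?dig //; lia.
  have rL1 : rows (memory s1) list0 (bundles E m).
    by move=> j jK y ym; rewrite out1 ?rL //; lia.
  run; apply: wp_frame (wp_check_bundles lay1 inp1 dig1 rL1 wK _ _) (leqnn _) _.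
    by rewrite fr1.
    by move=> x /zero[].
  move=> s2 fr2 [out2 used2 fail2].
  have lay2 := layout_frame fr2 isT lay1.
  have inp2 : inputs (memory s2).
    by apply: inputs_below inp1 => j jl; rewrite out2 ?jl.
  have dig2 : digits (memory s2).
    by move=> a an; rewrite out2 ?dig1 //; lia.
  (* The cells cleared at the start encode zero prices and no owners, for which the invariant of the
     auction is trivial. *)
  apply: wp_mono (wp_auction (p := fun=> 0) (o := fun=> None) lay2 inp2 used2 dig2 _ _ _)
    (leqnn _) _ => //.
  - by move=> x xm; have [_ p0 o0] := zero x xm; rewrite !out2 //; lia.
  - by move=> b [].
  move=> s3 [out3 fail3]; split; last by rewrite fail3 fail2.
  apply: same_outside_trans (same_outside_sub _ _ out3); [|lia|by []].
  apply: same_outside_trans (same_outside_sub _ _ out2); [|by []|lia].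
  exact: out1.
by rewrite /=; lia.
Qed.

End Word.

(** * Running through all words *)

Let b := (size (bundles E m)).+1.

(** [v] is the part of the word from position [i] on, where the carry has arrived; the induction
    follows the recursion of [next_word]. An empty [v] means [rA = n], that is, overflow. *)
Lemma wp_next_digits_loop i v s :
  layout s -> regs s rEnd = mark0 + b * m.+1 -> i + size v = n ->
  all (fun d => d < b) v ->
  (forall a, a < size v -> memory s (digits0 + (i + a)) = mark0 + nth 0 v a * m.+1) ->
  regs s rA = i -> regs s rCarry = 1 ->
  wp (While (Reg rCarry) (
    If (Reg rN :- Reg rA) (
      rDigit <:- Read (Reg rDigits :+ Reg rA) :+ Reg rStride ;;
      If (Reg rEnd :- Reg rDigit) (
        M[Reg rDigits :+ Reg rA] <:- Reg rDigit ;;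
        rCarry <:- Const 0)
      (
        M[Reg rDigits :+ Reg rA] <:- Reg rMark ;;
        rA <:- Reg rA :+ Const 1))
    (
      rCarry <:- Const 0 ;;
      rGo <:- Const 0))) s ((size v).+1 * 50) (fun s' =>
    same_outside (digits0 + i) single0 (memory s) (memory s') /\
    if next_word b v is Some v' then
      regs s' rGo = regs s rGo /\
      forall a, a < size v' -> memory s' (digits0 + (i + a)) = mark0 + nth 0 v' a * m.+1
    else regs s' rGo = 0).
Proof.
elim: v i s => [|d v IH] i s lay endE iv vb dig aE cE; set Q := (X in wp _ _ _ X).
  apply: wp_le; first apply: wp_while_true; first by rewrite /= cE.
    apply: (wp_if (T1 := 0)); first by rewrite /= aE (regN lay) -iv addn0 subnn.
    by move=> _; run; apply: wp_while_false.
  by [].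
have /andP[db vb'] : (d < b) && all (fun d => d < b) v by [].
have lt : i < n by rewrite -iv /= addnS ltnS leq_addr.
have dE : memory s (digits0 + i) = mark0 + d * m.+1.
  by have := dig 0 isT; rewrite addn0.
apply: (wp_le (T := (1 + (3 + 30 + 2).+1 + (size v).+1 * 50).+1)); last by rewrite /=; lia.
apply: wp_while_true; first by rewrite /= cE.
apply: wp_le; first (apply: (wp_if (T2 := 0)); last by rewrite /= aE (regN lay) => h; exfalso; lia).
  move=> _; run; rewrite aE (regDigits lay) dE (regStride lay).
  apply: wp_if; rewrite /= /update /= endE => h.
  - have db' : d.+1 < b.
      by rewrite ltnNge; apply/negP=> bd; move: h; rewrite -addnA -mulSnr; nia.
    run; rewrite aE (regDigits lay).
    apply: (wp_le (T := 2)) => //; apply: wp_while_false => //.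
    rewrite /Q /= db'; split.
      by move=> j jl; rewrite /= /update; case: eqP => // ?; lia.
    split=> // -[|a] ai /=; rewrite /update.
      by rewrite addn0 eqxx /= mulSnr addnA.
    by rewrite ifN ?dig //; lia.
  - have db' : (d.+1 < b) = false.
      by apply/negP=> bd; move: h; rewrite -addnA -mulSnr; nia.
    run; rewrite aE (regDigits lay) (regMark lay); set s1 := set_reg _ _ _.
    apply: wp_mono (IH i.+1 s1 _ _ _ vb' _ _ _) (leqnn _) _.
    + by case: lay; constructor.
    + by [].
    + by rewrite -iv addSnnS.
    + move=> a av; rewrite /= /update ifN; last by lia.
      by have := dig a.+1 av; rewrite addSnnS.
    + by rewrite /= /update /= addn1.
    + by [].
    move=> s2 [out2 next2]; rewrite /Q /= db'; split.
      move=> j jl; rewrite out2 /=; last by lia.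
      by rewrite /update ifN //; lia.
    move: next2; case: (next_word b v) => //= v' [go2 dig2]; split=> // -[|a] av.
      by rewrite out2 /= ?addn0 /update ?eqxx ?mul0n ?addn0 //; lia.
    by have := dig2 a av; rewrite addSnnS.
by [].
Qed.

Lemma wp_next_digits w s :
  layout s -> regs s rEnd = mark0 + b * m.+1 -> word b n w -> digits w (memory s) ->
  wp next_digits s (n.+1 * 50 + 10) (fun s' =>
    same_outside digits0 single0 (memory s) (memory s') /\
    if next_word b w is Some w' then
      regs s' rGo = regs s rGo /\ digits w' (memory s')
    else regs s' rGo = 0).
Proof.
move=> lay endE ww dig; have /andP[/eqP sw wb] := ww.
rewrite /next_digits; apply: wp_le; first run.
  set s1 := set_reg _ _ _.
  apply: wp_mono (wp_next_digits_loop (i := 0) (v := w) (s := s1) _ endE sw wb _ _ _)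
    (leqnn _) _ => //.
  - by case: lay; constructor.
  - by move=> a; rewrite sw; apply: dig.
  move=> s2 [out2 next2]; split; first by move=> j jl; rewrite out2 ?addn0.
  have := next_wordP ww; case: (next_word b w) next2 => // w' [go2 dig2] [/andP[/eqP sw' _] _].
  by split=> // a an; apply: dig2; rewrite sw'.
by rewrite sw /=; lia.
Qed.

Definition word_cost : nat :=
  n.+1 * ((n * m).+2 * (m.+1 * 40 + 100) + m.+1 * 40 + 80) + m.+1 * 23 + 20.

Lemma wp_search s :
  layout s -> inputs (memory s) -> rows (memory s) list0 (bundles E m) ->
  regs s rEnd = mark0 + b * m.+1 -> regs s rAns = 0 ->
  wp search s (n.+1 * 20 + b ^ n * (2 * word_cost + n.+1 * 100 + 100)) (fun s' =>
    regs s' rAns <> 0 <-> exists w, word b n w /\ good_word w).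
Proof.
move=> lay inp rL endE ans0; set Q := (X in wp _ _ _ X).
(* As [b ^ n] is positive, the extra round charged by [wp_while] is covered by doubling the cost of
   a word. *)
have bn0 : 0 < b ^ n by rewrite expn_gt0.
rewrite /search; apply: wp_le; first run.
  pose I i s' := same_outside digits0 single0 (memory s) (memory s') /\
    forall a, a < i -> memory s' (digits0 + a) = mark0.
  apply: (wp_for (I := I) (B := 6)) => //.
  - move=> i s1; rewrite (regN lay) => iN iE fr [out dig].
    have lay1 : layout s1 by apply: layout_frame fr isT _; case: lay; constructor.
    apply: wp_le; first run => //.
      rewrite iE (regDigits lay1) (regMark lay1); split=> [j jl|a] /=.
        by rewrite /update ifN ?out //; lia.
      rewrite ltnS leq_eqVlt /update eqn_add2l.
      by case: eqVneq => //= _; apply: dig.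
    by [].
  move=> s1 fr; rewrite (regN lay) => -[out1 dig1]; run; set s2 := set_reg _ _ _.
  have lay2 : layout s2 by case: (layout_frame fr isT lay); constructor.
  (* The value of the current word is both clock and certificate: [k] counts the words from it to
     the end, and every good word has at least this value, since all smaller ones were rejected. *)
  pose J k s' := [/\ layout s', same_outside used0 single0 (memory s) (memory s'),
    regs s' rEnd = mark0 + b * m.+1 &
    if regs s' rGo == 0 then Q s' else
      exists w, [/\ word b n w, digits w (memory s'), regs s' rAns = 0,
        k + word_value b w = b ^ n &
        forall w', word b n w' -> good_word w' -> word_value b w <= word_value b w']].
  apply: (wp_while (I := J) (k := b ^ n) (B := word_cost + n.+1 * 50 + 20)).
  - split=> //.
    + by move=> j jl; apply: out1; lia.
    + by rewrite /= /update /= fr.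
    rewrite /= /update /=; exists (nseq n 0); split=> //.
    + by rewrite /word size_nseq eqxx all_nseq orbT.
    + by move=> a an; rewrite /= dig1 // nth_nseq an addn0.
    + by rewrite fr.
    + by elim: (n) => [|k IH] /=; [rewrite addn0 | move: IH; rewrite expnS; lia].
    + move=> w' _ _; suff -> : word_value b (nseq n 0) = 0 by [].
      by elim: (n) => //= k ->; rewrite muln0.
  - move=> k s3 [lay3 out3 end3]; rewrite /= => inv go3; move: inv; rewrite (negPf go3).
    move=> [w [ww dig3 ans3 kE least]].
    have inp3 : inputs (memory s3).
      by apply: inputs_below inp => j jl; rewrite out3 ?jl.
    have rL3 : rows (memory s3) list0 (bundles E m).
      by move=> j jK y ym; rewrite out3 ?rL //; lia.
    have wK a : a < n -> nth 0 w a <= size (bundles E m).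
      move=> an; have /andP[/eqP sw /all_nthP wb] := ww.
      by have := wb 0 a; rewrite sw ltnS => /(_ an).
    have lt_bn w' : word b n w' -> word_value b w' < b ^ n.
      by move=> /andP[/eqP<- /word_value_lt].
    have wv := lt_bn w ww.
    apply: wp_le; first apply: wp_seq.
      apply: wp_frame (wp_check_word lay3 inp3 dig3 rL3 wK) (leqnn _) _.
      move=> s4 fr4 [out4 fail4].
      have lay4 := layout_frame fr4 isT lay3.
      have dig4 : digits w (memory s4) by move=> a an; rewrite out4 ?dig3 //; lia.
      have end4 : regs s4 rEnd = mark0 + b * m.+1 by rewrite fr4.
      have out34 := same_outside_trans out3
        (same_outside_sub (leqnn used0) (ltac:(lia) : digits0 <= single0) out4).
      apply: wp_if => /= h.
      + apply: wp_frame (wp_next_digits lay4 end4 ww dig4) (leqnn _) _.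
        move=> s5 fr5 [out5 next5]; exists k.-1; first by lia.
        have bad : ~ good_word w by move/fail4/eqP; rewrite (negPf h).
        have least' w' : word b n w' -> good_word w' ->
            (word_value b w).+1 <= word_value b w'.
          move=> ww' gw'; rewrite ltn_neqAle least // andbT.
          by apply/eqP=> /(word_value_inj ww ww') e; apply: bad; rewrite e.
        have lay5 := layout_frame fr5 isT lay4.
        have out35 : same_outside used0 single0 (memory s) (memory s5).
          apply: same_outside_trans out34 _; apply: same_outside_sub out5 => //; lia.
        split=> //; first by rewrite fr5.
        have := next_wordP ww; case: (next_word b w) next5 => [w' [go5 dig5] [ww' val']|go5 val'].
          rewrite go5 fr4 // (negPf go3); exists w'; split=> //; first by rewrite fr5 ?fr4.
            by rewrite val'; lia.
          by move=> w1 ww1 gw1; rewrite val'; apply: least'.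
        (* On overflow a good word would need value at least [b ^ n]. *)
        rewrite go5 /=; split; first by rewrite fr5 ?fr4.
        move=> [w' [ww' gw']]; have := least' w' ww' gw'; rewrite val'.
        by rewrite leqNgt lt_bn.
      + run; exists 0; first by lia.
        split=> //; first by case: lay4; constructor.
        rewrite /= /update /=; split=> // _; exists w; split=> //; exact/fail4.
    by rewrite /= /word_cost; lia.
  - move=> k s3 [_ _ _]; rewrite /= => + go0; by rewrite go0.
rewrite /= (regN lay); set c := word_cost; nia.
Qed.

(** * Initialization and the whole program *)

Lemma wp_setup s M0 :
  memory s = M0 -> regs s rN = n -> M0 1 = m -> M0 2 = eta ->
  (forall i, used0 <= i -> M0 i = 0) ->
  wp setup s ((n + m).+1 * 100) (fun s' =>
    [/\ layout s', same_below used0 M0 (memory s') &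
      rows (memory s') single0 (singletons m)]).
Proof.
move=> memE nE mE eE zero; set Q := (X in wp _ _ _ X).
rewrite /setup; apply: wp_le; first run.
  rewrite memE /= mE eE; set s1 := set_reg _ _ _.
  apply: (wp_for (I := fun i s' => regs s' rAdj = 3 + i * m /\ memory s' = M0) (B := 4)) => //.
  - move=> i s2 _ iE fr [aE me2]; run; split=> //.
    by rewrite /= /update /= aE fr //= /update /=; lia.
  move=> s2 fr2 [aE2 me2]; run; set s3 := set_reg _ _ _.
  apply: (wp_for_eq (k := m) (I := fun i s' => regs s' rUsed = adj0 + i * m /\ memory s' = M0) (B := 4)) => //.
  - by rewrite /= /update /= fr2.
  - split=> //; rewrite /= /update /= aE2 adj0E /= /update /= nE; lia.
  - move=> i s4 _ iE fr [uE me4]; run; split=> //.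
    by rewrite /= /update /= uE fr //= /update /= fr2 //= /update /=; lia.
  move=> s4 fr4 [uE4 me4]; run; set s5 := set_reg _ _ _.
  have m4 : regs s4 rM = m by rewrite fr4 //= /update /= fr2.
  have n4 : regs s4 rN = n by rewrite fr4 //= /update /= fr2.
  have a4 : regs s4 rAdj = adj0.
    by rewrite fr4 //= /update /= aE2 adj0E [regs s1 _]nE.
  have u4 : regs s4 rUsed = used0.
    by rewrite uE4 used0E.
  have st4 : regs s4 rStride = m.+1.
    by rewrite fr4 //= /update /= fr2 //= /update /= addn1.
  have e4 : regs s4 rEta = eta by rewrite fr4 //= /update /= fr2.
  pose I i s' := [/\ regs s' rMark = single0 + i * m.+1,
    same_below used0 M0 (memory s'),
    forall j, single0 + i * m.+1 <= j -> memory s' j = 0 &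
    rows (memory s') single0 (singletons i)].
  apply: (wp_for_eq (k := m) (I := I) (B := 10)) => //.
  - split=> //.
    + by rewrite /= /update /= u4 m4 n4; lia.
    + by rewrite /= me4.
    + by move=> j jl; rewrite /= me4 zero //; lia.
  - move=> i s6; move=> im iE fr6 [mk6 below6 zero6 r6].
    have st6 : regs s6 rStride = m.+1 by rewrite fr6.
    apply: wp_le; first run.
      rewrite mk6 iE st6; split=> /=.
      + by rewrite /update /=; lia.
      + by move=> j jl; rewrite /update ifN ?below6 //; nia.
      + by move=> j jl; rewrite /update ifN ?zero6 //; lia.
      + rewrite /singletons iota_rcons map_rcons -cats1; apply/rows_cat; split.
          apply: (rows_below (l := single0 + i * m.+1)) r6.
            by move=> j jl; rewrite /update ifN //; lia.
          by rewrite size_map size_iota.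
        rewrite size_map size_iota => -[|j] // _ y ym.
        rewrite mul0n addn0 /update eqn_add2l inE.
        by case: (eqVneq y i) => //= yi; rewrite zero6 // leq_addr.
    by [].
  move=> s6 fr6 [mk6 below6 _ r6].
  have n6 : regs s6 rN = n by rewrite fr6.
  have m6 : regs s6 rM = m by rewrite fr6.
  have e6 : regs s6 rEta = eta by rewrite fr6.
  have st6 : regs s6 rStride = m.+1 by rewrite fr6.
  have a6 : regs s6 rAdj = adj0 by rewrite fr6.
  have u6 : regs s6 rUsed = used0 by rewrite fr6.
  have p6 : regs s6 rPrice = price0.
    by rewrite fr6 //; change (regs s4 rUsed + regs s4 rM = price0); rewrite u4 m4 price0E.
  have o6 : regs s6 rOwner = owner0.
    rewrite fr6 //; change (regs s4 rUsed + regs s4 rM + regs s4 rM = owner0).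
    by rewrite u4 m4; lia.
  have d6 : regs s6 rDigits = digits0.
    rewrite fr6 //.
    change (regs s4 rUsed + regs s4 rM + regs s4 rM + regs s4 rM = digits0).
    by rewrite u4 m4; lia.
  have i6 : regs s6 rSingle = single0.
    rewrite fr6 //.
    change (regs s4 rUsed + regs s4 rM + regs s4 rM + regs s4 rM + regs s4 rN = single0).
    by rewrite u4 m4 n4; lia.
  run; split=> //; constructor=> //=; rewrite /update /= mk6 ?st6; lia.
rewrite [regs _ _]nE /=; lia.
Qed.

Lemma wp_allocate M0 :
  0 < n -> M0 0 = n -> M0 1 = m -> M0 2 = eta -> inputs M0 ->
  (forall i, used0 <= i -> M0 i = 0) ->
  wp allocate (State (fun=> 0) M0)
    ((n + m).+1 * 100 +
     (m.+1 * (m.+1 * (m.+1 * 30 + 40) + size (bundles E m) * (m.+1 * 30 + 40) + 50) + 10) +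
     (n.+1 * 20 + b ^ n * (2 * word_cost + n.+1 * 100 + 100)) + 10)
    (fun s' => regs s' rAns <> 0 <-> exists w, word b n w /\ good_word w).
Proof.
move=> n0 nE mE eE inp zero; set Q := (X in wp _ _ _ X).
rewrite /allocate; apply: wp_le; first run.
  rewrite nE; set s0 := set_reg _ _ _.
  apply: (wp_if (T2 := 0)) => /= h; last by rewrite /update /= in h; rewrite h in n0.
  run; apply: wp_frame (wp_setup (s := s0) (M0 := M0) _ _ mE eE zero) (leqnn _) _ => //.
  move=> s1 fr1 [lay1 below1 r1].
  run; apply: wp_frame (wp_enumerate lay1 (inputs_below below1 inp) r1) (leqnn _) _.
  move=> s2 fr2 [below2 r2 end2].
  have lay2 := layout_frame fr2 isT lay1.
  have inp2 : inputs (memory s2).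
    apply: inputs_below (inputs_below below1 inp) => j jl; apply: below2; lia.
  apply: wp_mono (wp_search lay2 inp2 r2 _ _) (leqnn _) _ => //.
    by rewrite end2 /b; lia.
  by rewrite fr2 ?fr1.
by rewrite /=; lia.
Qed.

End Layout.

(** * Counting cliques *)

Section Cliques.

Variables (T : finType) (r : rel T).
Hypotheses (r_sym : symmetric r) (r_irr : irreflexive r).

Definition nbrs (W : {set T}) (v : T) : {set T} := [set y in W | r v y].

Definition degree_sum (W : {set T}) : nat := \sum_(v in W) #|nbrs W v|.

Definition cliques (W : {set T}) : {set {set T}} :=
  [set S : {set T} | [&& S \subset W, 1 < #|S| &
     [forall x in S, forall y in S, (x != y) ==> r x y]]].

(** An edge at [v] is counted at both of its ends, which gives the factor 2. *)
Lemma degree_sum_rem (W : {set T}) v : v \in W ->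
  degree_sum W = degree_sum (W :\ v) + 2 * #|nbrs W v|.
Proof.
move=> vW.
have sumr : \sum_(u in W :\ v) (r u v : nat) = #|nbrs W v|.
  rewrite -sum1_card big_mkcond [RHS]big_mkcond; apply: eq_bigr => u _.
  rewrite !inE r_sym; have [->|_] := eqVneq u v; first by rewrite r_irr andbF.
  by case: (u \in W); case: (r v u).
rewrite /degree_sum (big_setD1 v) //=.
have -> : \sum_(u in W :\ v) #|nbrs W u| =
    \sum_(u in W :\ v) (r u v + #|nbrs (W :\ v) u|).
  apply: eq_bigr => u uW; rewrite (cardsD1 v) inE vW; congr (_ + _).
  by apply: eq_card => y; rewrite !inE andbA.
by rewrite big_split /= sumr; lia.
Qed.

(** The degree sum is twice the number of edges, hence the 2 on the left. Removing [v] deletes [k]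
    edges and at most [2 ^ k] cliques, and [2 ^ k <= k * 2 ^ d] because [1 <= k <= d], so the
    deleted edges pay for the deleted cliques. *)
Lemma card_cliques (d : nat) (W : {set T}) :
  (forall k, k * k.+1 <= degree_sum W -> k <= d) ->
  2 * #|cliques W| <= degree_sum W * 2 ^ d.
Proof.
have [n] := ubnP #|W|; elim: n W => // n IH W; rewrite ltnS => Wn hd.
have [/existsP[v0 /andP[v0W v0deg]]|none] :=
    boolP [exists v, (v \in W) && (0 < #|nbrs W v|)]; last first.
  suff -> : cliques W = set0 by rewrite cards0.
  apply/setP=> S; rewrite !inE; apply/negP=> /and3P[/subsetP SW /card_gt1P[x [y [xS yS xy]]]].
  move=> /forall_inP/(_ x xS)/forall_inP/(_ y yS)/implyP/(_ xy) rxy.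
  case/negP: none; apply/existsP; exists x; rewrite SW //=.
  by apply/card_gt0P; exists y; rewrite inE SW.
pose P v := (v \in W) && (0 < #|nbrs W v|).
have : P v0 by rewrite /P v0W.
case/(arg_minnP (fun v => #|nbrs W v|)) => v /andP[vW vdeg] min.
set k := #|nbrs W v| in vdeg min.
(* [v] and its [k] neighbours all have positive degree, hence degree at least [k] by minimality, so
   the degree sum is at least [k * k.+1]. *)
have kd : k <= d.
  apply: hd; rewrite /degree_sum.
  have vn : v \notin nbrs W v by rewrite inE r_irr andbF.
  have sub : v |: nbrs W v \subset W.
    by apply/subsetP=> y; rewrite !inE => /predU1P[->|/andP[]].
  rewrite (big_setID (v |: nbrs W v)) /= (setIidPr sub).
  apply: leq_trans (leq_addr _ _).
  have -> : k * k.+1 = \sum_(y in v |: nbrs W v) k.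
    by rewrite sum_nat_const cardsU1 vn mulnC.
  apply: leq_sum => y yN; apply: min; rewrite /P (subsetP sub) //=.
  apply/card_gt0P; move: yN; rewrite !inE => /predU1P[->|/andP[yW vy]].
    by have /card_gt0P := vdeg.
  by exists v; rewrite inE vW r_sym.
have W'n : #|W :\ v| < n by rewrite (cardsD1 v) vW in Wn.
have degE := degree_sum_rem vW.
have le' : 2 * #|cliques (W :\ v)| <= degree_sum (W :\ v) * 2 ^ d.
  by apply: IH => // j jle; apply: hd; rewrite degE; apply: leq_trans jle (leq_addr _ _).
(* A clique through [v] is determined by its other vertices, which are neighbours of [v]. *)
have sub : cliques W \subset cliques (W :\ v) :|: [set v |: S | S in powerset (nbrs W v)].
  apply/subsetP=> S; rewrite !inE => /and3P[SW S1 Sr].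
  have [vS|vS] := boolP (v \in S).
    apply/orP; right; apply/imsetP; exists (S :\ v); last by rewrite setD1K.
    rewrite inE; apply/subsetP=> y; rewrite !inE => /andP[yv yS].
    rewrite (subsetP SW) //=; have /forall_inP/(_ v vS)/forall_inP/(_ y yS)/implyP := Sr.
    by apply; rewrite eq_sym.
  by rewrite subsetD1 SW vS S1 Sr.
have card_le : #|cliques W| <= #|cliques (W :\ v)| + 2 ^ k.
  apply: leq_trans (subset_leq_card sub) _; apply: leq_trans (leq_card_setU _ _).1 _.
  by rewrite leq_add2l -card_powerset leq_imset_card.
have pow : 2 ^ k <= k * 2 ^ d.
  by apply: leq_trans (leq_pmull _ vdeg); rewrite leq_exp2l.
by rewrite degE; nia.
Qed.

End Cliques.

(** * The complement of the conflict graph *)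

Section Graph.

Variables (J : finType) (H : graph J).

Definition compatible_items : rel J := fun x y => (x != y) && ~~ adj H x y.

Lemma compatible_items_sym : symmetric compatible_items.
Proof. by move=> x y; rewrite /compatible_items eq_sym adj_sym. Qed.

Lemma compatible_items_irr : irreflexive compatible_items.
Proof. by move=> x; rewrite /compatible_items eqxx. Qed.

(** The ordered pairs of jobs contain four disjoint sets: the diagonal, the compatible pairs counted
    by the degree sum, and the adjacent pairs in increasing and in decreasing order. Each edge of
    [H] comes from an increasing pair, so [up] and [down] account for every edge twice. *)
Lemma degree_sum_missing : degree_sum compatible_items setT <= 2 * missing_edges H.
Proof.
pose up := [set p : J * J | adj H p.1 p.2 & enum_rank p.1 < enum_rank p.2].
pose down := [set p : J * J | adj H p.1 p.2 & enum_rank p.2 < enum_rank p.1].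
have edges_up : #|edges H| <= #|up|.
  apply: leq_trans (leq_imset_card (fun p => [set p.1; p.2]) up).
  apply/subset_leq_card/subsetP=> e /imsetP[[x y] /=]; rewrite inE /= => xy ->{e}.
  have [lt|gt|/val_inj/enum_rank_inj e] := ltngtP (enum_rank x) (enum_rank y).
  - by apply/imsetP; exists (x, y); rewrite // inE xy.
  - by apply/imsetP; exists (y, x); rewrite /= ?inE /= 1?adj_sym ?xy // setUC.
  - by rewrite e adj_irr in xy.
have up_down : #|up| = #|down|.
  rewrite -(card_imset up (f := fun p => (p.2, p.1))); last by move=> [? ?] [? ?] [-> ->].
  apply: eq_card => -[x y]; rewrite !inE /=; apply/imsetP/andP=> [[[y' x']]|[xy lt]].
    by rewrite inE /= => /andP[xy lt] [-> ->]; rewrite adj_sym.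
  by exists (y, x); rewrite // inE /= adj_sym xy.
pose P := [set p : J * J | compatible_items p.1 p.2].
have -> : degree_sum compatible_items setT = #|P|.
  rewrite /degree_sum -sum1_card; under eq_bigr => x _ do rewrite -sum1_card.
  rewrite pair_big_dep /=; apply: eq_bigl => -[x y]; by rewrite !inE.
pose diag := [set p : J * J | p.1 == p.2].
have diagE : #|diag| = #|J|.
  rewrite -(card_imset predT (f := fun x : J => (x, x))); last by move=> ? ? [].
  apply: eq_card => -[x y]; rewrite inE /=; apply/eqP/imsetP=> [->|[z _ [-> ->]] //].
  by exists y.
have total : #|P| + #|up| + #|down| + #|diag| <= #|J| * #|J|.
  rewrite -card_prod.
  have c4 (D : {set J * J}) : #|D| = \sum_p (p \in D : nat).
    by rewrite -sum1_card big_mkcond.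
  rewrite !c4 -!big_split /= -sum1_card; apply: leq_sum => -[x y] _.
  rewrite !inE /= /compatible_items.
  have [<-|xy] := eqVneq x y; first by rewrite adj_irr.
  case: (adj H x y) => //=; rewrite addn0 add0n.
  by case: ltngtP.
have := bin2 #|J|; rewrite /missing_edges.
have : 2 * 'C(#|J|, 2) = #|J| * #|J|.-1.
  by rewrite mul2n bin2 -[RHS](odd_double_half) oddM; case: #|J| => //= k; rewrite andNb.
case: #|J| total diagE => [|k]; nia.
Qed.

End Graph.

Lemma nth_allpairs (S T : Type) (R : Type) (f : S -> T -> R) s t x0 y0 z0 i j :
  i < size s -> j < size t ->
  nth z0 [seq f x y | x <- s, y <- t] (i * size t + j) = f (nth x0 s i) (nth y0 t j).
Proof.
elim: s i => //= x s IH [|i] iS jT; rewrite nth_cat size_map.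
  by rewrite mul0n add0n jT (nth_map y0).
rewrite mulSn -addnA ltnNge leq_addr /= addKn; exact: IH.
Qed.

(** * Allocations and words *)

Section Correctness.

Variables (A J : finType) (u : A -> J -> nat) (eta : nat) (H : graph J).

Let n := #|A|.
Let m := #|J|.

Definition utility_at (a x : nat) : nat :=
  if (insub a : option 'I_n, insub x : option 'I_m) is (Some i, Some j)
  then u (enum_val i) (enum_val j) else 0.

Definition adj_at (x y : nat) : bool :=
  if (insub x : option 'I_m, insub y : option 'I_m) is (Some i, Some j)
  then adj H (enum_val i) (enum_val j) else false.

Lemma utility_at_rank a x : utility_at (enum_rank a) (enum_rank x) = u a x.
Proof. by rewrite /utility_at !valK !enum_rankK. Qed.

Lemma adj_at_rank x y : adj_at (enum_rank x) (enum_rank y) = adj H x y.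
Proof. by rewrite /adj_at !valK !enum_rankK. Qed.

Lemma adj_at_sym : symmetric adj_at.
Proof.
move=> x y; rewrite /adj_at.
case: (insub x : option 'I_m) => [i|]; case: (insub y : option 'I_m) => [j|] //.
exact: adj_sym.
Qed.

Lemma adj_at_irr x : adj_at x x = false.
Proof. by rewrite /adj_at; case: insub => [i|] //; apply: adj_irr. Qed.

Lemma inputs_encode :
  inputs n m utility_at adj_at (3 + n * m) (nth 0 (encode u eta H)).
Proof.
have sA : size (enum A) = n by rewrite -cardE.
have sJ : size (enum J) = m by rewrite -cardE.
split=> [a x an xm|x y xm ym].
  have an' : a < size (enum A) by rewrite sA.
  have xm' : x < size (enum J) by rewrite sJ.
  have [a0 _] : exists a0 : A, true.
    by have /card_gt0P[a0 _] := leq_ltn_trans (leq0n a) an; exists a0.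
  have [x0 _] : exists x0 : J, true.
    by have /card_gt0P[x0 _] := leq_ltn_trans (leq0n x) xm; exists x0.
  rewrite /encode -addnA [nth _ _ _]/= nth_cat size_allpairs sA sJ.
  rewrite (_ : a * m + x < n * m); last by nia.
  rewrite -sJ (nth_allpairs _ a0 x0) // /utility_at (insubT (fun i => i < n) an) (insubT (fun i => i < m) xm) /=.
  by rewrite (enum_val_nth a0) (enum_val_nth x0).
have xm' : x < size (enum J) by rewrite sJ.
have ym' : y < size (enum J) by rewrite sJ.
have [x0 _] : exists x0 : J, true.
  by have /card_gt0P[x0 _] := leq_ltn_trans (leq0n x) xm; exists x0.
rewrite /encode -!addnA [nth _ _ _]/= nth_cat size_allpairs sA sJ ltnNge leq_addr /=.
rewrite ?add0n addKn -sJ (nth_allpairs _ x0 x0) // eqb0 negbK.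
rewrite /adj_at (insubT (fun i => i < m) xm) (insubT (fun i => i < m) ym) /=.
by rewrite !(enum_val_nth x0).
Qed.

Definition items (B : seq nat) : {set J} := [set x | val (enum_rank x) \in B].

(** Filtering the reversed [iota] yields the decreasing order in which [bundles] lists its elements,
    so [ranks] and [items] are inverse to each other on bundles. *)
Definition ranks (S : {set J}) : seq nat :=
  [seq i <- rev (iota 0 m) | if insub i is Some j then enum_val (j : 'I_#|J|) \in S else false].

Lemma mem_ranks S x : (val (enum_rank x) \in ranks S) = (x \in S).
Proof.
rewrite mem_filter valK enum_rankK mem_rev mem_iota /=.
by rewrite (ltn_ord (enum_rank x)) andbT.
Qed.

Lemma ranksE S i : i \in ranks S -> exists2 x, i = val (enum_rank x) & x \in S.
Proof.
rewrite mem_filter; case: insubP => //= j _ ji /andP[jS _].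
by exists (enum_val (j : 'I_#|J|)); rewrite // enum_valK.
Qed.

Lemma ranksK : cancel ranks items.
Proof. by move=> S; apply/setP=> x; rewrite inE mem_ranks. Qed.

Lemma ranks_lt S : all (gtn m) (ranks S).
Proof. by apply/allP=> i /ranksE[x -> _]; apply: ltn_ord. Qed.

Lemma ranks_sorted S : sorted gtn (ranks S).
Proof.
apply: sorted_filter; first by move=> y x z /= xy yz; apply: ltn_trans yz xy.
by rewrite rev_sorted iota_ltn_sorted.
Qed.

Lemma itemsK B : sorted gtn B -> all (gtn m) B -> ranks (items B) = B.
Proof.
move=> sB Bm; apply: (irr_sorted_eq (leT := gtn)) => //.
- by move=> y x z /= xy yz; apply: ltn_trans yz xy.
- by move=> x /=; rewrite ltnn.
- exact: ranks_sorted.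
move=> i; apply/idP/idP=> [/ranksE[x -> ]|iB]; first by rewrite inE.
have im := allP Bm i iB.
have <- : val (enum_rank (enum_val (Ordinal im))) = i by rewrite enum_valK.
by rewrite mem_ranks inE enum_valK.
Qed.

Lemma size_ranks S : size (ranks S) = #|S|.
Proof.
rewrite cardE -(size_map (fun x => val (enum_rank x))); apply/perm_size/uniq_perm.
- by rewrite filter_uniq // rev_uniq iota_uniq.
- by rewrite map_inj_uniq ?enum_uniq // => x y /val_inj/enum_rank_inj.
move=> i; apply/idP/mapP=> [/ranksE[x -> xS]|[x + ->]].
  by exists x; rewrite // mem_enum.
by rewrite mem_enum mem_ranks.
Qed.

Lemma mem_bundles_ranks S :
  (ranks S \in bundles adj_at m) = (1 < #|S|) && [forall x in S, forall y in S, ~~ adj H x y].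
Proof.
rewrite mem_bundles size_ranks ranks_sorted ranks_lt /=; congr (_ && _).
(* [pairwise] tests each pair in one order only; symmetry and irreflexivity of [adj_at] supply the
   other order and the diagonal. *)
have -> : pairwise (fun x y => ~~ adj_at x y) (ranks S) = all2rel (fun x y => ~~ adj_at x y) (ranks S).
  elim: (ranks S) => //= x s IH; rewrite IH allrel_consl allrel_consr /= adj_at_irr /=.
  rewrite andbA -[in RHS](@eq_all _ (fun y => ~~ adj_at x y)) ?andbb //.
  by move=> y; rewrite adj_at_sym.
apply/allrelP/forall_inP=> [h x xS|h i j /ranksE[x -> xS] /ranksE[y -> yS]].
  by apply/forall_inP=> y yS; rewrite -adj_at_rank; apply: h; rewrite mem_ranks.
by rewrite adj_at_rank; have /forall_inP := h x xS; apply.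
Qed.

Lemma bundlesP B : B \in bundles adj_at m -> ranks (items B) = B.
Proof. by rewrite mem_bundles => /and4P[_ sB Bm _]; apply: itemsK. Qed.

Lemma size_bundles : size (bundles adj_at m) <= #|cliques (compatible_items H) setT|.
Proof.
rewrite -(size_map items) cardE; apply: uniq_leq_size.
  rewrite map_inj_in_uniq ?bundles_uniq // => B C /bundlesP {2}<- /bundlesP {2}<-.
  by move=> ->.
move=> _ /mapP[B BB ->]; rewrite mem_enum inE subsetT /=.
have := BB; rewrite -(bundlesP BB) mem_bundles_ranks ranksK => /andP[-> /forall_inP h] /=.
apply/forall_inP=> x xB; apply/forall_inP=> y yB; apply/implyP=> xy.
by rewrite /compatible_items xy; have /forall_inP := h x xB; apply.
Qed.

Lemma utilityE a S :
  utility utility_at (val (enum_rank a)) (ranks S) m = \sum_(x in S) u a x.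
Proof.
rewrite /utility -[m in iota 0 m]subn0 -/(index_iota 0 m) big_mkord.
rewrite (reindex_onto (fun x : J => enum_rank x) (fun i => enum_val i)) /=; last first.
  by move=> i _; rewrite enum_valK.
apply: eq_big => [x|x _]; last by rewrite utility_at_rank.
by rewrite mem_ranks enum_rankK eqxx andbT.
Qed.

Let K := size (bundles adj_at m).

Lemma CFFA_good_word : 0 < eta ->
  CFFA u eta H <-> exists w, word K.+1 n w /\ good_word n m eta utility_at adj_at w.
Proof.
move=> eta0; split=> [[phi [phiP disj]]|[w [ww [[ok1 ok2] [f [fP f_inj]]]]]].
  (* The successor keeps letter 0 for agents with a single job. *)
  pose digit (i : nat) := if insub i is Some j then
      let S := phi (enum_val (j : 'I_n)) in
      if 1 < #|S| then (index (ranks S) (bundles adj_at m)).+1 else 0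
    else 0.
  have inB a : 1 < #|phi a| -> ranks (phi a) \in bundles adj_at m.
    move=> S1; rewrite mem_bundles_ranks S1; apply/forall_inP=> x xS.
    by apply/forall_inP=> y yS; apply: (phiP a).1.
  pose w := mkseq digit n.
  have wE a : nth 0 w (enum_rank a) =
      if 1 < #|phi a| then (index (ranks (phi a)) (bundles adj_at m)).+1 else 0.
    by rewrite nth_mkseq // /digit valK enum_rankK.
  have bE a : nth [::] ([::] :: bundles adj_at m) (nth 0 w (enum_rank a)) =
      if 1 < #|phi a| then ranks (phi a) else [::].
    by rewrite wE; case: ifP => //= S1; rewrite nth_index // inB.
  have rankP i : i < n -> exists a : A, i = val (enum_rank a).
    by move=> lt; exists (enum_val (Ordinal lt)); rewrite enum_valK.
  have rankJ i : i < m -> exists x : J, i = val (enum_rank x).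
    by move=> lt; exists (enum_val (Ordinal lt)); rewrite enum_valK.
  have disjP a b x : x \in phi a -> x \in phi b -> a = b.
    move=> xa xb; apply/eqP/negPn/negP=> /disj/pred0P/(_ x) /=.
    by rewrite xa xb.
  have sub a x : val (enum_rank x) \in
      nth [::] ([::] :: bundles adj_at m) (nth 0 w (enum_rank a)) -> x \in phi a.
    by rewrite bE; case: ifP => // _; rewrite mem_ranks.
  exists w; split.
    rewrite /word size_mkseq eqxx /=; apply/(all_nthP 0) => i; rewrite size_mkseq => lt.
    have [a ->] := rankP i lt; rewrite wE; case: ifP => // S1.
    by rewrite ltnS index_mem inB.
  split; first split.
  - move=> i lt; have [a ->] := rankP i lt; rewrite bE wE; case: ifP => // _ _.
    by rewrite utilityE; apply: (phiP a).2.
  - move=> i j k ij jn km.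
    have [a ia] := rankP i (ltn_trans ij jn); have [b jb] := rankP j jn.
    have [x ->] := rankJ k km; rewrite ia jb => /sub xa; apply/negP=> /sub xb.
    by move: ij; rewrite ia jb (disjP a b x xa xb) ltnn.
  (* An empty set has utility 0, which is below the positive [eta]. *)
  have phi0 a : exists x, x \in phi a.
    apply/set0Pn; apply/eqP=> S0; have [_] := phiP a.
    by rewrite S0 big_set0; lia.
  have small a : nth 0 w (enum_rank a) == 0 -> exists x, phi a = [set x].
    rewrite wE; case: ifP => // S1 _; apply/cards1P; have [x xS] := phi0 a.
    by rewrite eqn_leq; have : 0 < #|phi a| by [apply/card_gt0P; exists x]; lia.
  pose f (i : nat) : nat := if insub i is Some j then
      if [pick x in phi (enum_val (j : 'I_n))] is Some x then val (enum_rank x) else 0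
    else 0.
  have fE a : exists2 x, x \in phi a & f (enum_rank a) = val (enum_rank x).
    rewrite /f valK enum_rankK; case: pickP => [x xS|none]; first by exists x.
    by have [x] := phi0 a; rewrite none.
  exists f; split=> [i lt|i j lti ltj].
    have [a ->] := rankP i lt => sa; have [x xa ->] := fE a.
    split; first exact: ltn_ord.
    apply/andP; split.
      apply/hasPn=> j; rewrite mem_iota /= => jn; have [b ->] := rankP j jn.
      apply/negP=> /[dup] /sub xb; rewrite -(disjP a b x xa xb) bE.
      by move: sa; rewrite wE; case: ifP.
    rewrite utility_at_rank; have [y Sy] := small a sa.
    have [_] := phiP a; rewrite Sy big_set1.
    by move: xa; rewrite Sy inE => /eqP->.
  have [a ->] := rankP i lti; have [b ->] := rankP j ltj => _ _.
  have [x xa ->] := fE a; have [y yb ->] := fE b => /val_inj/enum_rank_inj xy.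
  by rewrite (disjP a b x xa) // xy.
have wK a : nth 0 w (val (enum_rank (a : A))) < K.+1.
  have /andP[/eqP sw /all_nthP wb] := ww.
  by apply: wb; rewrite sw; apply: ltn_ord.
pose bun (a : A) := nth [::] ([::] :: bundles adj_at m) (nth 0 w (enum_rank a)).
have bunP a : nth 0 w (enum_rank a) != 0 -> bun a \in bundles adj_at m.
  by have := wK a; rewrite /bun; case: (nth 0 w _) => // k kK _; apply: mem_nth.
pose phi (a : A) := if nth 0 w (enum_rank a) == 0
  then [set x | val (enum_rank x) == f (enum_rank a)] else items (bun a).
have in_bun a b x : x \in items (bun a) -> x \in items (bun b) -> a = b.
  rewrite !inE => xa xb; apply/enum_rank_inj/val_inj.
  have [lt|lt|//] := ltngtP (val (enum_rank a)) (val (enum_rank b)).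
    by have := ok2 _ _ _ lt (ltn_ord _) (ltn_ord _) xa; rewrite xb.
  by have := ok2 _ _ _ lt (ltn_ord _) (ltn_ord _) xb; rewrite xa.
(* [acc] excludes every job that occurs in a bundle, so the matching cannot collide with the
   bundles. *)
have free (a b : A) x : nth 0 w (enum_rank a) == 0 -> val (enum_rank x) = f (enum_rank a) ->
    x \notin items (bun b).
  move=> wa xf; have [_ /andP[/hasPn none _]] := fP _ (ltn_ord (enum_rank a)) wa.
  by rewrite inE xf; apply: none; rewrite mem_iota ltn_ord.
exists phi; split=> [a|a b ab].
  rewrite /phi; case: ifP => wa.
    have [fm /andP[_ fu]] := fP _ (ltn_ord (enum_rank a)) wa.
    pose x := enum_val (Ordinal fm : 'I_#|J|).
    have xE : val (enum_rank x) = f (enum_rank a) by rewrite enum_valK.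
    have -> : [set y | val (enum_rank y) == f (enum_rank a)] = [set x].
      by apply/setP=> y; rewrite !inE -xE val_eqE (inj_eq enum_rank_inj).
    split; last by rewrite big_set1 -utility_at_rank xE.
    by move=> y z; rewrite !inE => /eqP-> /eqP->; rewrite adj_irr.
  have bB := bunP a (negbT wa); split.
    have := mem_bundles_ranks (items (bun a)).
    rewrite (bundlesP bB) bB => /esym/andP[_ /forall_inP h].
    by move=> x y xS yS; have /forall_inP := h x xS; apply.
  by rewrite -utilityE (bundlesP bB); apply: ok1; rewrite ?wa ?ltn_ord.
apply/pred0P=> x /=; apply/negP=> /andP[]; rewrite /phi.
have single (c : A) : nth 0 w (enum_rank c) == 0 ->
    x \in [set y | val (enum_rank y) == f (enum_rank c)] -> val (enum_rank x) = f (enum_rank c).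
  by move=> _; rewrite inE => /eqP.
case: ifP => wa; case: ifP => wb.
- move=> /(single a wa) xa /(single b wb) xb; case/eqP: ab; apply/enum_rank_inj/val_inj.
  by apply: f_inj (etrans (esym xa) xb) => //; apply: ltn_ord.
- by move=> /(single a wa) xa xb; have /negP := free a b x wa xa; apply.
- by move=> xa /(single b wb) xb; have /negP := free b a x wb xb; apply.
- by move=> xa xb; case/eqP: ab; apply: in_bun xa xb.
Qed.

End Correctness.

(** * The running time *)

(** With [n + m] positive, a power of [n + m] dominates constants and lower powers; at [n + m = 0] a
    positive power would vanish. *)
Definition poly_bounded (f : nat -> nat -> nat) : Prop :=
  exists C k, forall n m, 0 < n + m -> f n m <= C * (n + m) ^ k.

Lemma poly_bounded_const c : poly_bounded (fun _ _ => c).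
Proof. by exists c, 0 => n m _; rewrite expn0 muln1. Qed.

Lemma poly_bounded_fst : poly_bounded (fun n _ => n).
Proof. by exists 1, 1 => n m _; rewrite expn1 mul1n leq_addr. Qed.

Lemma poly_bounded_snd : poly_bounded (fun _ m => m).
Proof. by exists 1, 1 => n m _; rewrite expn1 mul1n leq_addl. Qed.

Lemma poly_bounded_add f g : poly_bounded f -> poly_bounded g ->
  poly_bounded (fun n m => f n m + g n m).
Proof.
move=> [C [k fP]] [D [l gP]]; exists (C + D), (k + l) => n m nm.
rewrite mulnDl leq_add //.
  by apply: leq_trans (fP n m nm) _; rewrite leq_mul2l leq_pexp2l ?leq_addr ?orbT.
by apply: leq_trans (gP n m nm) _; rewrite leq_mul2l leq_pexp2l ?leq_addl ?orbT.
Qed.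

Lemma poly_bounded_mul f g : poly_bounded f -> poly_bounded g ->
  poly_bounded (fun n m => f n m * g n m).
Proof.
move=> [C [k fP]] [D [l gP]]; exists (C * D), (k + l) => n m nm.
by rewrite expnD mulnACA leq_mul ?fP ?gP.
Qed.

Lemma poly_bounded_succ f : poly_bounded f -> poly_bounded (fun n m => (f n m).+1).
Proof.
move=> fP; have [C [k h]] := poly_bounded_add fP (poly_bounded_const 1).
by exists C, k => n m /h; rewrite addn1.
Qed.

(** Obtained from the time in [wp_allocate] by replacing the factors [K] and [b ^ n] by 1; each
    summand there is at most [(K + 1) ^ n] times its counterpart here when [n] is positive. *)
Definition overhead (n m : nat) : nat :=
  (n + m).+1 * 100 +
  (m.+1 * (m.+1 * (m.+1 * 30 + 40) + (m.+1 * 30 + 40) + 50) + 10) +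
  (n.+1 * 20 + (2 * word_cost n m + n.+1 * 100 + 100)) + 10.

Lemma poly_bounded_overhead : poly_bounded overhead.
Proof.
rewrite /overhead /word_cost.
by repeat first [exact: poly_bounded_const | exact: poly_bounded_fst
  | exact: poly_bounded_snd | apply: poly_bounded_add | apply: poly_bounded_mul
  | apply: poly_bounded_succ].
Qed.

Lemma allocate_correct (A J : finType) (u : A -> J -> nat) (eta : nat) (H : graph J) :
  0 < eta ->
  wp allocate (init (encode u eta H))
    ((size (bundles (adj_at H) #|J|)).+1 ^ #|A| * overhead #|A| #|J|)
    (fun s' => accepting s' <-> CFFA u eta H).
Proof.
move=> eta0; set n := #|A|; set m := #|J|.
have [n0|n0] := posnP n.
  apply: (wp_le (T := 10)).
    rewrite /allocate; apply: wp_le; first run.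
      apply: (wp_if (T1 := 0)) => /= h; first by rewrite /update /= -/n n0 in h.
      run; split=> // _; have A0 (a : A) : False by apply: fintype0 a n0.
      by exists (fun=> set0); split=> a; case: (A0 a).
    by [].
  by rewrite n0 expn0 mul1n /overhead; lia.
have sA : size (enum A) = n by rewrite -cardE.
have sJ : size (enum J) = m by rewrite -cardE.
have zero i : 3 + n * m + m * m <= i -> nth 0 (encode u eta H) i = 0.
  move=> le; rewrite nth_default // /encode !size_cat !size_allpairs sA sJ /=; lia.
set K := size _.
apply: wp_mono (wp_allocate (M0 := nth 0 (encode u eta H)) (U := utility_at u) (E := adj_at H)
  erefl erefl erefl erefl erefl erefl erefl erefl n0 _ _ _ (inputs_encode u eta H) zero) _ _ => //.
  rewrite -/m -/K.
  (* The inequality needs [0 < n]; it makes the words pay for the enumeration. *)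
  have Kle : K.+1 <= K.+1 ^ n by rewrite -[X in X <= _]expn1 leq_pexp2l.
  move: (K.+1 ^ n) Kle => X KX; rewrite /overhead; set c := word_cost n m.
  set p := m.+1 * 30 + 40.
  nia.
by move=> s' sP; apply: (iff_trans sP); apply: iff_sym; apply: CFFA_good_word.
Qed.

Import Order.TTheory GRing.Theory Num.Theory.
Local Open Scope ring_scope.

Lemma size_bundles_le (R : realType) (J : finType) (H : graph J) :
  (size (bundles (adj_at H) #|J|)).+1%:R <=
    2 * (missing_edges H)%:R * 2 `^ (2 * Num.sqrt (missing_edges H)%:R) + 1 :> R.
Proof.
set t := missing_edges H; have P0 : exists k, (k * k.+1 <= 2 * t)%N by exists 0.
(* A crude bound on the candidates, so that a largest [d] exists. *)
have Pm k : (k * k.+1 <= 2 * t)%N -> (k <= 2 * t)%N by case: k => // k; nia.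
have [d dP dmax] := ex_maxnP P0 Pm.
have tP := degree_sum_missing H.
have := card_cliques (compatible_items_sym H) (compatible_items_irr H) (d := d) (W := setT).
move=> /(_ _)/wrap[k kP|cP]; first by apply: dmax; apply: leq_trans kP tP.
have KP : (size (bundles (adj_at H) #|J|) <= t * 2 ^ d)%N.
  by have := size_bundles H; nia.
(* After squaring this reads [d ^ 2 <= 4 * t], which follows from [d * (d + 1) <= 2 * t]. *)
have dt : d%:R <= 2 * Num.sqrt t%:R :> R.
  rewrite -(@ler_pXn2r _ 2) // ?nnegrE ?ler0n ?mulr_ge0 ?sqrtr_ge0 //.
  rewrite exprMn sqr_sqrtr ?ler0n // -!natrX -natrM ler_nat; nia.
have pow : (2 ^ d)%:R <= 2 `^ (2 * Num.sqrt t%:R) :> R.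
  by rewrite natrX -powR_mulrn ?ler0n // ler_powR ?ler1n.
rewrite -natr1 lerD2r; apply: (@le_trans _ _ (t * 2 ^ d)%:R); first by rewrite ler_nat.
rewrite natrM; apply: ler_pM => //.
by rewrite ler_peMl ?ler1n.
Qed.

Theorem theorem6 (R : realType) :
  exists (p : program) (C k : nat),
    forall (A J : finType) (u : A -> J -> nat) (eta : nat) (H : graph J),
      (0 < eta)%N ->
      let n := #|A| in
      let m := #|J| in
      let t := missing_edges H in
      exists (T : nat) (s : state),
        [/\ exec p (init (encode u eta H)) T s,
            accepting s <-> CFFA u eta H &
            (0 < n + m)%N ->
            T%:R <= C%:R * ((2 * t%:R * 2 `^ (2 * Num.sqrt t%:R) + 1) ^+ n
                            * (n + m)%:R ^+ k) :> R].
Proof.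
have [C [k overheadP]] := poly_bounded_overhead.
exists allocate, C, k => A J u eta H eta0 n m t.
have [T [s [ex Tle sP]]] := allocate_correct u H eta0.
exists T, s; split=> // nm.
apply: (@le_trans _ _ (((size (bundles (adj_at H) m)).+1 ^ n)%:R * (C * (n + m) ^ k)%:R)).
  by rewrite -natrM ler_nat; apply: leq_trans Tle _; rewrite leq_mul2l overheadP ?orbT.
rewrite natrM natrX natrX mulrCA ler_wpM2l ?ler0n // ler_wpM2r ?exprn_ge0 ?ler0n //.
by rewrite lerXn2r ?nnegrE ?ler0n ?size_bundles_le // (le_trans _ (size_bundles_le R H)).
Qed.
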